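(* For every positive integer $n$, $\theta(K_{n,n,n}\times K_2)=\lceil (n+1)/2\rceil$.
   Context: The thickness $\theta(G)$ of a graph $G$ is the minimum number of planar subgraphs whose union is $G$. The Kronecker product $G\times H$ of graphs $G$ and $H$ is the graph with vertex set $V(G)\times V(H)$ in which $(g,h)$ and $(g',h')$ are adjacent if and only if $gg'\in E(G)$ and $hh'\in E(H)$. $K_{n,n,n}$ denotes the complete tripartite graph with three parts of size $n$. *)

(* Defs.v *)
From Stdlib Require Import Reals.
From mathcomp Require Import all_boot.

Set Implicit Arguments.
Unset Strict Implicit.
Unset Printing Implicit Defensive.

Definition pt := (R * R)%type.

Definition cont01 (c : R -> pt) : Prop :=
  forall t : R, (Rle 0 t /\ Rle t 1) -> forall eps : R, Rlt 0 eps ->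
  exists delta : R, Rlt 0 delta /\
    forall s : R, (Rle 0 s /\ Rle s 1) -> Rlt (Rabs (Rminus s t)) delta ->
      Rlt (Rabs (Rminus (fst (c s)) (fst (c t)))) eps /\
      Rlt (Rabs (Rminus (snd (c s)) (snd (c t)))) eps.

Definition jordan_arc (c : R -> pt) (p q : pt) : Prop :=
  cont01 c /\
  (forall s t : R, (Rle 0 s /\ Rle s 1) -> (Rle 0 t /\ Rle t 1) -> c s = c t -> s = t) /\
  c R0 = p /\ c R1 = q.

Definition planar (V : finType) (e : rel V) : Prop :=
  exists (pos : V -> pt) (c : V -> V -> R -> pt),
    injective pos /\
    (forall u v, e u v -> jordan_arc (c u v) (pos u) (pos v)) /\
    (forall u v w, e u v -> forall t : R, (Rlt 0 t /\ Rlt t 1) -> c u v t <> pos w) /\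
    (forall u v u' v', e u v -> e u' v' ->
       ~ ((u = u' /\ v = v') \/ (u = v' /\ v = u')) ->
       forall s t : R, (Rlt 0 s /\ Rlt s 1) -> (Rlt 0 t /\ Rlt t 1) -> c u v s <> c u' v' t).

(** G = (V, e) is the union of k planar subgraphs (spanning subgraphs:
    isolated vertices do not affect planarity). *)
Definition planar_decomp (V : finType) (e : rel V) (k : nat) : Prop :=
  exists F : 'I_k -> rel V,
    (forall i u v, F i u v -> e u v) /\
    (forall i, planar (F i)) /\
    (forall u v, e u v -> exists i, F i u v).

Definition thickness_is (V : finType) (e : rel V) (k : nat) : Prop :=
  planar_decomp e k /\ (forall m, planar_decomp e m -> k <= m).

Definition kron (A B : finType) (G : rel A) (H : rel B) : rel (A * B) :=
  fun x y => G x.1 y.1 && H x.2 y.2.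

Definition Knnn (n : nat) : rel ('I_3 * 'I_n) :=
  fun x y => x.1 != y.1.

Arguments Knnn n : clear implicits.

Definition K2 : rel bool := fun a b => a != b.

(* Main.v *)
(** Lower bound: a bipartite planar graph with V > 0 vertices has E <= 2V - 2 edges.  Indeed,
    compactness turns a drawing by Jordan arcs into a minor of a fine square grid.
    Face boundaries of the grid span its cycle space, each edge lying on two of them, and this
    (Mac Lane's condition) passes to the minor: the cycle space, of dimension at least
    E - V + 1, is spanned by circulations that have at least four edges each and use every edge at
    most twice, so 4(E - V + 1) <= 2E.  As the product has 6n vertices and 6n^2 edges,
    m layers require 6n^2 <= m(12n - 2), hence m > n/2.

    Upper bound: K_3 x K_2 is a 6-cycle, so the graph has parts V_0, ..., V_5 of size n with
    consecutive parts completely joined.  Put p = n/2 (rounded down) and let P_i be the r-th pair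
    {2r, 2r+1} of V_i.  The r-th layer joins P_0 to V_1, P_1 to V_2, ..., P_5 to V_0, drawn as
    nested rhombi with each pair at opposite points of a coordinate axis; it misses the edges
    P_5-P_0 and, when n is odd, those between the leftover vertices c_i = 2p and
    V_{i+1}.  One extra layer takes the missing edges, once c_5 has been moved inside P_0 (so that
    layer r contains c_5-P_0 instead of P_4-c_5), without which it would contain K_{3,3}. *)
Require Import Defs.
From Stdlib Require Import Reals Lra Lia Classical ClassicalEpsilon.
From Coquelicot Require Rcomplements Compactness.
From mathcomp Require Import all_boot.
Set Implicit Arguments.
Unset Strict Implicit.
Unset Printing Implicit Defensive.

(** * Plane arcs and compactness *)

Section Topology.
Local Open Scope R_scope.

Definition near (r : R) (p q : pt) : Prop :=
  Rabs (p.1 - q.1) < r /\ Rabs (p.2 - q.2) < r.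

Lemma near_sym r p q : near r p q -> near r q p.
Proof. by case=> h1 h2; split; rewrite Rabs_minus_sym. Qed.

Lemma near_trans r s p q t : near r p q -> near s q t -> near (r + s) p t.
Proof.
by case=> a1 a2 [b1 b2]; split; move: a1 a2 b1 b2; split_Rabs; lra.
Qed.

Lemma near_le r s p q : r <= s -> near r p q -> near s p q.
Proof. by move=> rs [h1 h2]; split; lra. Qed.

Lemma not_near p q : p <> q -> exists r, 0 < r /\ ~ near r p q.
Proof.
case: p q => [a b] [c d] pq.
have [ac|ac] := classic (a = c); [have bd : b <> d by move=> E; apply: pq; rewrite ac E|].
  exists (Rabs (b - d)); split; first by apply: Rabs_pos_lt; lra.
  by case=> /= _; lra.
exists (Rabs (a - c)); split; first by apply: Rabs_pos_lt; lra.
by case=> /=; lra.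
Qed.

(* [P s t r] gets weaker as [r] decreases; this is compactness of the unit square. *)
Lemma unif_square (P : R -> R -> R -> Prop) :
  (forall s t r r', 0 < r' <= r -> P s t r -> P s t r') ->
  (forall u v, 0 <= u <= 1 -> 0 <= v <= 1 -> exists d, 0 < d /\
     forall s t, 0 <= s <= 1 -> 0 <= t <= 1 -> Rabs (s - u) < d -> Rabs (t - v) < d -> P s t d) ->
  exists d, 0 < d /\ forall s t, 0 <= s <= 1 -> 0 <= t <= 1 -> P s t d.
Proof.
move=> mono loc.
(* The gauge has to be a total function on the plane, so it takes the dummy value 1 outside the
   square. *)
have ex u v : exists d : posreal, 0 <= u <= 1 -> 0 <= v <= 1 ->
    forall s t, 0 <= s <= 1 -> 0 <= t <= 1 -> Rabs (s - u) < d -> Rabs (t - v) < d -> P s t d.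
  have [[hu hv]|no] := classic ((0 <= u <= 1) /\ (0 <= v <= 1)); last first.
    by exists (mkposreal 1 Rlt_0_1) => hu hv; case: no.
  by have [d [d0 dP]] := loc u v hu hv; exists (mkposreal d d0).
pose delta u v := proj1_sig (constructive_indefinite_description _ (ex u v)).
have deltaP u v := proj2_sig (constructive_indefinite_description _ (ex u v)).
have [d dP] := Compactness.compactness_value_2d 0 1 0 1 delta.
exists d; split; first exact: cond_pos.
move=> s t hs ht; have [u [v [hu [hv [su [tv dd]]]]]] := NNPP _ (dP s t hs ht).
apply: (mono _ _ (delta u v)); first by split=> //; exact: cond_pos.
exact: deltaP.
Qed.

Lemma unif_segment (P : R -> R -> Prop) :
  (forall t r r', 0 < r' <= r -> P t r -> P t r') ->
  (forall u, 0 <= u <= 1 -> exists d, 0 < d /\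
     forall t, 0 <= t <= 1 -> Rabs (t - u) < d -> P t d) ->
  exists d, 0 < d /\ forall t, 0 <= t <= 1 -> P t d.
Proof.
move=> mono loc.
have [|u v hu _|d [d0 dP]] := @unif_square (fun s _ => P s).
- by move=> s _; apply: mono.
- by have [d [d0 dP]] := loc u hu; exists d; split => // s t hs _ su _; apply: dP.
by exists d; split=> // t ht; apply: (dP t t).
Qed.

Lemma unif_finite (T : finType) (P : T -> R -> Prop) :
  (forall x r r', 0 < r' <= r -> P x r -> P x r') ->
  (forall x, exists d, 0 < d /\ P x d) -> exists d, 0 < d /\ forall x, P x d.
Proof.
move=> mono ex.
suff [d [d0 dP]] : exists d, 0 < d /\ forall x, x \in enum T -> P x d.
  by exists d; split=> // x; apply: dP; rewrite mem_enum.
elim: (enum T) => [|y s [d [d0 dP]]]; first by exists 1; split; [lra|].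
have [d' [d0' dP']] := ex y.
have m1 := Rmin_l d d'; have m2 := Rmin_r d d'; have m0 := Rmin_pos _ _ d0 d0'.
exists (Rmin d d'); split=> // x; rewrite inE => /orP[/eqP->|xs].
  exact: (mono _ d').
by apply: (mono _ d) => //; apply: dP.
Qed.

Lemma cont_near c t r : cont01 c -> 0 <= t <= 1 -> 0 < r ->
  exists d, 0 < d /\ forall s, 0 <= s <= 1 -> Rabs (s - t) < d -> near r (c s) (c t).
Proof. by move=> cc ht hr; have [d [d0 dP]] := cc t ht r hr; exists d. Qed.

Lemma arc_unif_cont c r : cont01 c -> 0 < r ->
  exists d, 0 < d /\ forall s t, 0 <= s <= 1 -> 0 <= t <= 1 -> Rabs (s - t) < d ->
    near r (c s) (c t).
Proof.
move=> cc r0.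
have [|u v hu hv|d [d0 dP]] :=
  @unif_square (fun s t d => Rabs (s - t) < d -> near r (c s) (c t)).
- by move=> s t a b ab h st; apply: h; lra.
(* Off the diagonal, a quarter of |u - v| makes the premise on |s - t| false; on it, both values are
   compared with [c u]. *)
- have [<-|uv] := classic (u = v); last first.
    have m : 0 < Rabs (u - v) by apply: Rabs_pos_lt; lra.
    exists (Rabs (u - v) / 4); split; first by lra.
    by move=> s t _ _ h1 h2 h3; exfalso; move: m h1 h2 h3; split_Rabs; lra.
  have [|d [d0 dP]] := cont_near (r := r / 2) cc hu; first by lra.
  exists d; split=> // s t hs ht su tu _.
  rewrite (_ : r = r / 2 + r / 2); last by lra.
  exact: near_trans (dP s hs su) (near_sym (dP t ht tu)).
by exists d; split=> // s t hs ht; apply: dP.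
Qed.

Lemma arc_avoids_point c p : cont01 c -> (forall t, 0 <= t <= 1 -> c t <> p) ->
  exists d, 0 < d /\ forall t, 0 <= t <= 1 -> ~ near d (c t) p.
Proof.
move=> cc cp; apply: unif_segment => [t r r' rr h n|u hu].
  by apply: h; apply: near_le n; lra.
have [r [r0 nr]] := not_near (cp u hu).
have [|d [d0 dP]] := cont_near (r := r / 2) cc hu; first by lra.
have m1 := Rmin_l d (r / 2); have m2 := Rmin_r d (r / 2).
exists (Rmin d (r / 2)); split; first by apply: Rmin_pos; lra.
move=> t ht tu n; apply: nr; rewrite (_ : r = r / 2 + r / 2); last by lra.
have h1 : near (r / 2) (c t) (c u) by apply: dP => //; lra.
exact: near_trans (near_sym h1) (near_le m2 n).
Qed.

Lemma near_open r p q : near r p q ->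
  exists m, 0 < m /\ forall p', near m p' p -> near r p' q.
Proof.
case=> h1 h2.
have [a aE] : exists a, a = r - Rabs (p.1 - q.1) by eexists.
have [b bE] : exists b, b = r - Rabs (p.2 - q.2) by eexists.
have m1 := Rmin_l a b; have m2 := Rmin_r a b.
exists (Rmin a b); split; first by apply: Rmin_pos; lra.
move=> p' [n1 n2]; split.
  have := Rabs_triang (p'.1 - p.1) (p.1 - q.1).
  by rewrite (_ : p'.1 - p.1 + (p.1 - q.1) = p'.1 - q.1); [lra|ring].
have := Rabs_triang (p'.2 - p.2) (p.2 - q.2).
by rewrite (_ : p'.2 - p.2 + (p.2 - q.2) = p'.2 - q.2); [lra|ring].
Qed.

(** Compactness over pairs of parameters: where [c u <> c' v], continuity keeps the arcs a positive
    distance apart nearby; where [c u] is in a ball around [p] or [q], it stays there because the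
    ball is open. *)
Lemma arcs_apart c c' p q r : cont01 c -> cont01 c' ->
  (forall s t, 0 <= s <= 1 -> 0 <= t <= 1 ->
     c s <> c' t \/ near r (c s) p \/ near r (c s) q) ->
  exists d, 0 < d /\ forall s t, 0 <= s <= 1 -> 0 <= t <= 1 ->
    near d (c s) (c' t) -> near r (c s) p \/ near r (c s) q.
Proof.
move=> cc cc' H.
apply: unif_square => [s t a b ab h n|u v hu hv].
  by apply: h; apply: near_le n; lra.
have ball x : near r (c u) x -> exists d, 0 < d /\
    forall s, 0 <= s <= 1 -> Rabs (s - u) < d -> near r (c s) x.
  case/near_open => m [m0 mP]; have [d [d0 dP]] := cont_near cc hu m0.
  by exists d; split => // s hs su; apply/mP/dP.
have [ne|[/ball|/ball]] := H u v hu hv; last first.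
- by case=> d [d0 dP]; exists d; split=> // s t hs ht su _ _; right; apply: dP.
- by case=> d [d0 dP]; exists d; split=> // s t hs ht su _ _; left; apply: dP.
have [a [a0 na]] := not_near ne.
have [|d [d0 dP]] := cont_near (r := a / 3) cc hu; first by lra.
have [|d' [d0' dP']] := cont_near (r := a / 3) cc' hv; first by lra.
have m1 := Rmin_l (Rmin d d') (a / 3); have m2 := Rmin_r (Rmin d d') (a / 3).
have m3 := Rmin_l d d'; have m4 := Rmin_r d d'.
exists (Rmin (Rmin d d') (a / 3)); split; first by repeat apply: Rmin_pos; lra.
move=> s t hs ht su tv n; case: na; rewrite (_ : a = a / 3 + a / 3 + a / 3); last by lra.
have h1 : near (a / 3) (c s) (c u) by apply: dP => //; lra.
have h2 : near (a / 3) (c' t) (c' v) by apply: dP' => //; lra.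
exact: near_trans (near_trans (near_sym h1) (near_le m2 n)) h2.
Qed.

End Topology.

(** * Connectivity in the square grid *)

Section Grid.
Variable N : nat.
Notation node := ('I_N.+1 * 'I_N.+1)%type.

Definition grid_step (x y : node) : bool :=
  [|| (x.1.+1 == y.1 :> nat) && (x.2 == y.2), (y.1.+1 == x.1 :> nat) && (x.2 == y.2),
      (x.1 == y.1) && (x.2.+1 == y.2 :> nat) | (x.1 == y.1) && (y.2.+1 == x.2 :> nat)].

Definition within (A : pred node) : rel node := fun x y => [&& grid_step x y, A x & A y].

(** When opposite sides of the grid are glued into a torus, every wrap-around edge has an end in row
    or column 0, so none joins two inner nodes. *)
Definition grid_inner : pred node := fun x => (0 < x.1) && (0 < x.2).

Lemma within_connect_sym A : connect_sym (within A).
Proof.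
apply: sym_connect_sym => x y; rewrite /within; congr (_ && _); last exact: andbC.
rewrite /grid_step ![y.1 == x.1]eq_sym ![y.2 == x.2]eq_sym.
by do 4 case: (_ == _); do 2 case: (_ == _).
Qed.

Lemma connect_line (A : pred node) (f : 'I_N.+1 -> node) (i j : 'I_N.+1) :
  (forall a b : 'I_N.+1, a.+1 = b -> grid_step (f a) (f b)) -> i <= j ->
  (forall k : 'I_N.+1, i <= k <= j -> A (f k)) -> connect (within A) (f i) (f j).
Proof.
move=> fs; have [n] := ubnP (j : nat); elim: n j => // n IH j ltj ij Ak.
case: (ltngtP i j) ij => // [lt|E] _; last by rewrite (val_inj E) connect0.
have lt' : j.-1 < N.+1 by apply: leq_ltn_trans (leq_pred _) (ltn_ord j).
pose j' := Ordinal lt'.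
have jE : j'.+1 = j by rewrite /= prednK //; apply: leq_ltn_trans lt.
have ij' : i <= j' by rewrite -ltnS jE.
have j'j : j' <= j by exact: leq_pred.
apply: (connect_trans (y := f j')); last first.
  apply/connect1/and3P; split; [exact: fs|by apply: Ak; rewrite ij'|].
  by apply: Ak; rewrite leqnn ltnW.
apply: IH => //; first by rewrite -ltnS jE.
by move=> k /andP[ik kj]; apply: Ak; rewrite ik (leq_trans kj).
Qed.

End Grid.

(** * From arcs to grid walks *)

(* [B w] holds the grid points close to the vertex [w], [W u v] those very close to the arc of
   [u v]: two arcs may share grid points only close to an endpoint. *)
Record grid_drawing (V : finType) (e : rel V) (N : nat)
    (B : V -> pred ('I_N.+1 * 'I_N.+1)) (W : V -> V -> pred ('I_N.+1 * 'I_N.+1)) : Prop := {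
  ball_inner : forall w x, B w x -> grid_inner x;
  walk_inner : forall u v x, e u v -> W u v x -> grid_inner x;
  ball_disj : forall w w' x, B w x -> B w' x -> w = w';
  ball_conn : forall w x y, B w x -> B w y -> connect (within (B w)) x y;
  ball_ex : forall w, exists x, B w x;
  walk_conn : forall u v, e u v ->
    exists a b, [/\ B u a, B v b, W u v a & connect (within (W u v)) a b];
  walk_ball : forall u v w x, e u v -> W u v x -> B w x -> w = u \/ w = v;
  walk_walk : forall u v u' v' x, e u v -> e u' v' -> (u, v) <> (u', v') ->
    W u v x -> W u' v' x -> B u x || B v x }.

Section Discretization.
Local Open Scope R_scope.

Definition decide (P : Prop) : bool := if excluded_middle_informative P then true else false.

Lemma decideP (P : Prop) : reflect P (decide P).
Proof. by rewrite /decide; case: excluded_middle_informative => ?; constructor. Qed.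

(** * Cells of a grid of mesh [h], and arcs traced through them *)

Section Cells.
Variables (N : nat) (h o : R).
Hypothesis h0 : 0 < h.
Notation node := ('I_N.+1 * 'I_N.+1)%type.

(** The offset [o] lets nodes, whose indices are natural numbers, surround the origin. A node is the
    lower left corner of its half-open cell. *)
Definition grid_pt (x : node) : pt := (INR x.1 * h - o, INR x.2 * h - o).

Definition cell (x : node) (p : pt) : Prop :=
  (INR x.1 * h <= p.1 + o < INR x.1 * h + h) /\ (INR x.2 * h <= p.2 + o < INR x.2 * h + h).

Lemma cell_near x p : cell x p -> near h (grid_pt x) p.
Proof. by case=> a b; split=> /=; split_Rabs; lra. Qed.

Lemma nfloor_scaled (a : R) : 0 <= a < INR N * h ->
  exists k : 'I_N.+1, INR k * h <= a < INR k * h + h.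
Proof.
move=> [a0 aN]; have [|n [n1 n2]] := Rcomplements.nfloor_ex (a / h).
  by apply: Rcomplements.Rdiv_le_0_compat.
have E : a / h * h = a by field; lra.
have l1 : INR n * h <= a by rewrite -E; apply: Rmult_le_compat_r; lra.
have l2 : a < INR n * h + h.
  by rewrite -E; have := Rmult_lt_compat_r h _ _ h0 n2; lra.
have nN : (n < N.+1)%N.
  rewrite ltnS; apply: ltnW; apply/ltP/INR_lt; apply: (Rmult_lt_reg_r h) => //; lra.
by exists (Ordinal nN).
Qed.

Lemma cell_ex p : 0 <= p.1 + o < INR N * h -> 0 <= p.2 + o < INR N * h -> exists x, cell x p.
Proof.
by move=> /nfloor_scaled[i hi] /nfloor_scaled[j hj]; exists (i, j).
Qed.

Lemma coord_step (i j : 'I_N.+1) a b : INR i * h <= a < INR i * h + h ->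
  INR j * h <= b < INR j * h + h -> Rabs (a - b) < h ->
  [\/ i = j, i.+1 = j :> nat | j.+1 = i :> nat].
Proof.
move=> hi hj ab.
have lt (k l : nat) : INR k * h < INR l * h + 2 * h -> (k <= l.+1)%N.
  move=> H; apply/leP; apply: INR_le; rewrite S_INR.
  have : INR k < INR l + 2 by apply: (Rmult_lt_reg_r h) => //; lra.
  rewrite (_ : INR l + 2 = INR l.+2); last by rewrite !S_INR; lra.
  by move/INR_lt/ltP; rewrite ltnS => /leP/le_INR; rewrite S_INR.
have h1 : (i <= j.+1)%N by apply: lt; move: ab; split_Rabs; lra.
have h2 : (j <= i.+1)%N by apply: lt; move: ab; split_Rabs; lra.
case: (ltngtP i j) => [ij|ij|/val_inj]; last by constructor 1.
  by constructor 2; apply/eqP; rewrite eqn_leq ij.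
by constructor 3; apply/eqP; rewrite eqn_leq ij.
Qed.

Lemma cell_connect (A : pred node) x y p q : cell x p -> cell y q -> near h p q ->
  (forall z, near (2 * h) (grid_pt z) p -> A z) -> connect (within A) x y.
Proof.
move=> [x1 x2] [y1 y2] [n1 n2] HA.
have Ax : A x by apply: HA; split=> /=; split_Rabs; lra.
have Ay : A y by apply: HA; split=> /=; move: n1 n2; split_Rabs; lra.
(* The indices of [x] and [y] differ by at most one in each direction, so the path is an L with this
   corner. *)
have Az : A (y.1, x.2) by apply: HA; split=> /=; move: n1 n2; split_Rabs; lra.
apply: (connect_trans (y := (y.1, x.2))).
  rewrite [x]surjective_pairing in Ax *.
  case: (coord_step (a := p.1 + o) (b := q.1 + o) x1 y1); first by move: n1; split_Rabs; lra.
  - by move=> ->; rewrite connect0.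
  - by move=> E; apply/connect1/and3P; split=> //; rewrite /grid_step /= E !eqxx.
  - by move=> E; apply/connect1/and3P; split=> //; rewrite /grid_step /= E !eqxx ?orbT.
rewrite [y]surjective_pairing in Ay *.
case: (coord_step (a := p.2 + o) (b := q.2 + o) x2 y2); first by move: n2; split_Rabs; lra.
- by move=> /= ->; rewrite connect0.
- by move=> E; apply/connect1/and3P; split=> //; rewrite /grid_step /= E !eqxx ?orbT.
- by move=> E; apply/connect1/and3P; split=> //; rewrite /grid_step /= E !eqxx ?orbT.
Qed.

(** The nodes close to a point form a product of two intervals, so an L-shaped path between two of
    them never leaves the set. *)
Lemma box_connect (A : pred node) r p : (forall z, reflect (near r (grid_pt z) p) (A z)) ->
  forall x y, A x -> A y -> connect (within A) x y.
Proof.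
move=> AP.
have mid (i k j : 'I_N.+1) a : (i <= k <= j)%N -> Rabs (INR i * h - o - a) < r ->
    Rabs (INR j * h - o - a) < r -> Rabs (INR k * h - o - a) < r.
  case/andP => /leP/le_INR ik /leP/le_INR kj.
  have := Rmult_le_compat_r h _ _ (Rlt_le _ _ h0) ik.
  have := Rmult_le_compat_r h _ _ (Rlt_le _ _ h0) kj.
  by split_Rabs; lra.
have hor (i i' j : 'I_N.+1) : A (i, j) -> A (i', j) -> connect (within A) (i, j) (i', j).
  wlog le : i i' / (i <= i')%N => [W Ai Ai'|].
    have [le|/ltnW le] := leqP i i'; first exact: W.
    by rewrite within_connect_sym; apply: W.
  move=> /AP[/= a1 a2] /AP[/= b1 _].
  apply: (connect_line (f := fun i => (i, j))) => // [a b E|k ik].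
    by rewrite /grid_step /= E !eqxx.
  by apply/AP; split=> //=; apply: mid ik _ _.
have ver (j j' i : 'I_N.+1) : A (i, j) -> A (i, j') -> connect (within A) (i, j) (i, j').
  wlog le : j j' / (j <= j')%N => [W Aj Aj'|].
    have [le|/ltnW le] := leqP j j'; first exact: W.
    by rewrite within_connect_sym; apply: W.
  move=> /AP[/= a1 a2] /AP[/= _ b2].
  apply: (connect_line (f := fun j => (i, j))) => // [a b E|k ik].
    by rewrite /grid_step /= E !eqxx ?orbT.
  by apply/AP; split=> //=; apply: mid ik _ _.
move=> [i j] [i' j'] Ax Ay.
have Am : A (i', j) by case/AP: Ax => /= ? ?; case/AP: Ay => /= ? ?; apply/AP.
exact: connect_trans (hor _ _ _ Ax Am) (ver _ _ _ Am Ay).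
Qed.

(** The arc is sampled at the multiples of 1/K with 1/K < d; consecutive samples are within [h], so
    their cells are joined by [cell_connect]. *)
Lemma walk_connect (A : pred node) (c : R -> pt) (d : R) x y : 0 < d ->
  (forall s t, 0 <= s <= 1 -> 0 <= t <= 1 -> Rabs (s - t) < d -> near h (c s) (c t)) ->
  (forall t, 0 <= t <= 1 -> exists z, cell z (c t)) ->
  (forall t z, 0 <= t <= 1 -> near (2 * h) (grid_pt z) (c t) -> A z) ->
  cell x (c 0) -> cell y (c 1) -> connect (within A) x y.
Proof.
move=> d0 cd cc cA cx cy.
have [K [K0 Kd]] : exists K : nat, (0 < K)%N /\ / INR K < d.
  have [K [Kd K0]] := archimed_cor1 d d0.
  by exists K; split=> //; apply/ltP.
have Kp : 0 < INR K by apply: lt_0_INR; apply/ltP.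
suff H (k : nat) z : (k <= K)%N -> cell z (c (INR k / INR K)) -> connect (within A) x z.
  by apply: (H K) => //; rewrite Rdiv_diag //; lra.
have rng (k' : nat) : (k' <= K)%N -> 0 <= INR k' / INR K <= 1.
  move=> /leP/le_INR kK; split; first by apply: Rcomplements.Rdiv_le_0_compat => //; exact: pos_INR.
  by apply/Rcomplements.Rle_div_l => //; lra.
elim: k z => [|k IH] z kK cz.
  have E : INR 0 / INR K = 0 by rewrite /Rdiv Rmult_0_l.
  rewrite E in cz; apply: (cell_connect cx cz); last by move=> w; apply: cA; lra.
  by apply: cd; rewrite ?Rminus_diag ?Rabs_R0; lra.
have [w cw] := cc _ (rng k (ltnW kK)).
apply: connect_trans (IH w (ltnW kK) cw) _.
apply: (cell_connect cw cz); last by move=> v; apply: cA; apply: rng; apply: ltnW.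
apply: cd; [exact: rng (ltnW kK)|exact: rng|].
rewrite S_INR (_ : _ - _ = - / INR K); last by field; lra.
by rewrite Rabs_Ropp Rabs_right //; apply: Rle_ge; apply: Rlt_le; apply: Rinv_0_lt_compat.
Qed.

End Cells.
End Discretization.

(** * Choice of the mesh for a planar drawing *)

Section PlanarGrid.
Local Open Scope R_scope.

Lemma inv_antitone r r' : 0 < r' <= r -> / r <= / r'.
Proof. by case=> h1 h2; apply: Rinv_le_contravar. Qed.

(** Large radii are written [/ r], so that the property gets weaker as [r] decreases, as the
    uniformity lemmas require. *)
Lemma near_origin p : exists r, 0 < r /\ near (/ r) p (0, 0).
Proof.
have a1 := Rabs_pos p.1; have a2 := Rabs_pos p.2.
exists (/ (Rabs p.1 + Rabs p.2 + 1)); split; first by apply: Rinv_0_lt_compat; lra.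
by rewrite Rinv_inv; split; rewrite /= Rminus_0_r; lra.
Qed.

Lemma arc_bounded c : cont01 c ->
  exists r, 0 < r /\ forall t, 0 <= t <= 1 -> near (/ r) (c t) (0, 0).
Proof.
move=> cc; apply: unif_segment => [t r r' rr n|u hu].
  by apply: near_le n; apply: inv_antitone.
have [d [d0 dP]] := cont_near cc hu Rlt_0_1.
have [r [r0 rP]] := near_origin (c u).
have i0 := Rinv_0_lt_compat _ r0.
have i1 : 0 < / (1 + / r) by apply: Rinv_0_lt_compat; lra.
have m1 := Rmin_l d (/ (1 + / r)); have m2 := Rmin_r d (/ (1 + / r)).
have m0 := Rmin_pos _ _ d0 i1.
exists (Rmin d (/ (1 + / r))); split=> // t ht tu.
apply: near_le (near_trans (dP t ht _) rP); last by lra.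
by rewrite -[X in X <= _]Rinv_inv; apply: Rinv_le_contravar.
Qed.

Lemma planar_grid (V : finType) (e : rel V) (col : V -> bool) :
  (forall u v, e u v -> ~~ col u && col v) -> planar e ->
  exists N B W, grid_drawing (N := N) e B W.
Proof.
move=> bip [pos [c [pinj [arc [avoid cross]]]]].
have cc u v : e u v -> cont01 (c u v) by case/arc.
have c0 u v : e u v -> c u v 0 = pos u by case/arc=> _ [_ []].
have c1 u v : e u v -> c u v 1 = pos v by case/arc=> _ [_ []].
have inside t : 0 <= t <= 1 -> [\/ t = 0, t = 1 | 0 < t < 1].
  move=> ht; have [->|t0] := classic (t = 0); first by constructor 1.
  have [->|t1] := classic (t = 1); first by constructor 2.
  by constructor 3; lra.
have [r1 [r1_gt0 r1P]] : exists r, 0 < r /\ forall x : V * V, x.1 <> x.2 ->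
    ~ near r (pos x.1) (pos x.2).
  apply: unif_finite => [x r r' rr h ne n|[u v] /=].
    by apply: (h ne); apply: near_le n; lra.
  have [->|uv] := classic (u = v); first by exists 1; split; [lra|].
  have [|r [r0 rP]] := @not_near (pos u) (pos v); first by move/pinj.
  by exists r.
have [r2 [r2_gt0 r2P]] : exists r, 0 < r /\ forall x : V * V * V,
    e x.1.1 x.1.2 -> x.2 <> x.1.1 -> x.2 <> x.1.2 ->
    forall t, 0 <= t <= 1 -> ~ near r (c x.1.1 x.1.2 t) (pos x.2).
  apply: unif_finite => [x r r' rr h h1 h2 h3 t ht n|[[u v] w] /=].
    by apply: (h h1 h2 h3 t ht); apply: near_le n; lra.
  have [euv|neuv] := boolP (e u v); last by exists 1; split; [lra|].
  have [->|wu] := classic (w = u); first by exists 1; split; [lra|].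
  have [->|wv] := classic (w = v); first by exists 1; split; [lra|].
  have [|r [r0 rP]] := @arc_avoids_point (c u v) (pos w) (cc _ _ euv); last by exists r.
  move=> t /inside[->|->|ht]; [rewrite c0 // => /pinj /esym //|rewrite c1 // => /pinj /esym //|].
  exact: avoid.
(* Balls will have radius 2r: a node in two of them would put their centres within 4r. *)
have [r [r_gt0 [rr1 rr2]]] : exists r, 0 < r /\ 4 * r <= r1 /\ 4 * r <= r2.
  have m1 := Rmin_l r1 r2; have m2 := Rmin_r r1 r2; have m0 := Rmin_pos _ _ r1_gt0 r2_gt0.
  by exists (Rmin r1 r2 / 4); lra.
have near_self p : near r p p by split; rewrite Rminus_diag Rabs_R0.
have [d [d_gt0 dP]] : exists d, 0 < d /\ forall x : (V * V) * (V * V),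
    e x.1.1 x.1.2 -> e x.2.1 x.2.2 -> x.1 <> x.2 ->
    forall s t, 0 <= s <= 1 -> 0 <= t <= 1 -> near d (c x.1.1 x.1.2 s) (c x.2.1 x.2.2 t) ->
    near r (c x.1.1 x.1.2 s) (pos x.1.1) \/ near r (c x.1.1 x.1.2 s) (pos x.1.2).
  apply: unif_finite => [x a b ab h h1 h2 h3 s t hs ht n|[[u v] [u' v']] /=].
    by apply: (h h1 h2 h3 s t hs ht); apply: near_le n; lra.
  have [euv|neuv] := boolP (e u v); last by exists 1; split; [lra|].
  have [euv'|neuv'] := boolP (e u' v'); last by exists 1; split; [lra|].
  have [->|ne] := classic ((u, v) = (u', v')); first by exists 1; split; [lra|].
  have [|a [a0 aP]] := @arcs_apart _ _ (pos u) (pos v) r (cc _ _ euv) (cc _ _ euv').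
    move=> s t /inside[->|->|hs] ht; first by right; left; rewrite c0.
      by right; right; rewrite c1.
    left; case/inside: ht => [->|->|ht]; [rewrite c0 //; exact: avoid|rewrite c1 //; exact: avoid|].
    (* [cross] says nothing about an edge and its reverse; the colouring excludes that pair, since
       every edge goes from colour false to colour true. *)
    apply: cross => //; case=> -[E1 E2]; first by apply: ne; rewrite E1 E2.
    by have := bip _ _ euv; have := bip _ _ euv'; rewrite E1 E2; case: (col u'); rewrite ?andbF.
  by exists a.
(* Walk nodes lie within 2h of their arc. A node shared by two walks brings the arcs within 4h <= d,
   so the arc is within r of an endpoint there and the node within r + 2h <= 2r of it. *)
have [h [h0 [hr hd]]] : exists h, 0 < h /\ 2 * h <= r /\ 4 * h <= d.
  have m1 := Rmin_l r d; have m2 := Rmin_r r d; have m0 := Rmin_pos _ _ r_gt0 d_gt0.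
  by exists (Rmin r d / 4); lra.
have [dl [dl_gt0 dlP]] : exists a, 0 < a /\ forall x : V * V, e x.1 x.2 ->
    forall s t, 0 <= s <= 1 -> 0 <= t <= 1 -> Rabs (s - t) < a ->
    near h (c x.1 x.2 s) (c x.1 x.2 t).
  apply: unif_finite => [x a b ab hx ex s t hs ht st|[u v] /=].
    by apply: hx => //; lra.
  have [euv|neuv] := boolP (e u v); last by exists 1; split; [lra|].
  by have [a [a0 aP]] := arc_unif_cont (cc _ _ euv) h0; exists a.
have [M [M0 [MP MC]]] : exists M, 0 < M /\ (forall w, near M (pos w) (0, 0)) /\
    (forall u v t, e u v -> 0 <= t <= 1 -> near M (c u v t) (0, 0)).
  have [a [a0 aP]] : exists a, 0 < a /\ forall w, near (/ a) (pos w) (0, 0).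
    apply: unif_finite => [x a b ab n|w]; last exact: near_origin.
    by apply: near_le n; apply: inv_antitone.
  have [b [b0 bP]] : exists b, 0 < b /\ forall x : V * V, e x.1 x.2 ->
      forall t, 0 <= t <= 1 -> near (/ b) (c x.1 x.2 t) (0, 0).
    apply: unif_finite => [x b b' bb hx ex t ht|[u v] /=].
      by apply: near_le (hx ex t ht); apply: inv_antitone.
    have [euv|neuv] := boolP (e u v); last by exists 1; split; [lra|].
    by have [b [b0 bP]] := arc_bounded (cc _ _ euv); exists b.
  have a0' := Rinv_0_lt_compat _ a0; have b0' := Rinv_0_lt_compat _ b0.
  exists (/ a + / b); split; first by lra.
  split=> [w|u v t euv ht]; first by apply: near_le (aP w); lra.
  by apply: near_le (bP (u, v) euv t ht); lra.
(* The margin 4r gives positive indices to all nodes that are close to the drawing. *)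
pose o := M + 4 * r.
have [N NP] := INR_archimed h (2 * M + 4 * r) h0.
have cell_M p : near M p (0, 0) -> exists x : 'I_N.+1 * 'I_N.+1, cell h o x p.
  case=> /=; rewrite !Rminus_0_r => n1 n2.
  by apply: cell_ex => //; rewrite /o; move: n1 n2; split_Rabs; lra.
have inner_M s (x : 'I_N.+1 * 'I_N.+1) p : near M p (0, 0) -> s <= 4 * r ->
    near s (grid_pt h o x) p -> grid_inner x.
  case=> /=; rewrite !Rminus_0_r => n1 n2 sr [/= n3 n4].
  have pos_nat (k : nat) a : Rabs a < M -> Rabs (INR k * h - o - a) < s -> (0 < k)%N.
    case: k => // ha; rewrite /= Rmult_0_l /o => hb; exfalso.
    by move: ha hb; split_Rabs; lra.
  by apply/andP; split; [apply: pos_nat n1 n3|apply: pos_nat n2 n4].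
pose B w : pred ('I_N.+1 * 'I_N.+1) := fun x => decide (near (2 * r) (grid_pt h o x) (pos w)).
pose W u v : pred ('I_N.+1 * 'I_N.+1) := fun x =>
  decide (exists t, 0 <= t <= 1 /\ near (2 * h) (grid_pt h o x) (c u v t)).
have cell_B x w : cell h o x (pos w) -> B w x.
  by move/(cell_near h0) => n; apply/decideP; apply: near_le n; lra.
exists N, B, W; split.
- by move=> w x /decideP; apply: inner_M => //; lra.
- move=> u v x euv /decideP[t [ht]]; apply: inner_M; [exact: MC|lra].
- move=> w w' x /decideP n /decideP n'; apply: NNPP => ww.
  apply: (r1P (w, w') ww); apply: near_le (near_trans (near_sym n) n'); lra.
- move=> w; by apply: (box_connect (r := 2 * r) (p := pos w) h0 (o := o)) => z; exact: decideP.
- by move=> w; have [x cx] := cell_M _ (MP w); exists x; apply: cell_B.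
- move=> u v euv.
  have [x cx] := cell_M _ (MP u); have [y cy] := cell_M _ (MP v).
  exists x, y; split; try exact: cell_B.
    apply/decideP; exists 0; split; first by lra.
    by rewrite c0 //; apply: near_le (cell_near h0 cx); lra.
  apply: (walk_connect (c := c u v) (d := dl) (o := o) h0) => //.
  + exact: (dlP (u, v)).
  + by move=> t ht; apply/cell_M/MC.
  + by move=> t z ht n; apply/decideP; exists t.
  + by rewrite c0.
  + by rewrite c1.
- move=> u v w x euv /decideP[t [ht n]] /decideP n'.
  have [|wu] := classic (w = u); first by left.
  have [|wv] := classic (w = v); first by right.
  exfalso; apply: (r2P (u, v, w) euv wu wv t ht).
  apply: near_le (near_trans (near_sym n) n'); lra.
move=> u v u' v' x euv euv' ne /decideP[s [hs ns]] /decideP[t [ht nt]].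
have n1 : near d (c u v s) (c u' v' t).
  by apply: near_le (near_trans (near_sym ns) nt); lra.
apply/orP; case: (dP ((u, v), (u', v')) euv euv' ne s t hs ht n1) => n; [left|right];
  by apply/decideP; apply: near_le (near_trans ns n) => /=; lra.
Qed.

End PlanarGrid.

(** * Drawings on the coordinate axes *)

Section CrossDrawing.
Local Open Scope R_scope.
Variables (V : finType) (e : rel V) (axis neg : V -> bool) (mag : V -> nat).

(** The successor keeps vertices away from the origin, which the two axes share. *)
Definition coord (v : V) : R := if neg v then - INR (mag v).+1 else INR (mag v).+1.
Definition cross_pos (v : V) : pt := if axis v then (0, coord v) else (coord v, 0).
Definition segment (p q : pt) (t : R) : pt :=
  ((1 - t) * p.1 + t * q.1, (1 - t) * p.2 + t * q.2).

Lemma coord_neq0 v : coord v <> 0.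
Proof.
by rewrite /coord; have := pos_INR (mag v); rewrite S_INR; case: (neg v); lra.
Qed.

Lemma segment_jordan p q : p <> q -> jordan_arc (segment p q) p q.
Proof.
case: p q => [a b] [c d] pq; split; [|split; [|by split; rewrite /segment /=; f_equal; ring]].
  (* A Lipschitz constant for both coordinates; the 1 makes it positive. *)
  move=> t ht eps he; pose K := Rabs (c - a) + Rabs (d - b) + 1.
  have p1 := Rabs_pos (c - a); have p2 := Rabs_pos (d - b).
  have K0 : 0 < K by rewrite /K; lra.
  exists (eps / K); split; first exact: Rdiv_lt_0_compat.
  move=> s hs st; have st' : Rabs (s - t) * K < eps.
    by have := Rmult_lt_compat_r K _ _ K0 st; rewrite /Rdiv Rmult_assoc Rinv_l; lra.
  have p3 := Rabs_pos (s - t).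
  rewrite /segment /=; split.
    rewrite (_ : _ - _ = (s - t) * (c - a)); last by ring.
    by rewrite Rabs_mult; apply: Rle_lt_trans st'; apply: Rmult_le_compat_l; rewrite /K; lra.
  rewrite (_ : _ - _ = (s - t) * (d - b)); last by ring.
  by rewrite Rabs_mult; apply: Rle_lt_trans st'; apply: Rmult_le_compat_l; rewrite /K; lra.
move=> s t _ _ [h1 h2].
have e1 : (s - t) * (c - a) = 0 by lra.
have e2 : (s - t) * (d - b) = 0 by lra.
have [//|st] := classic (s = t); case: pq.
by have [|h1'] := Rmult_integral _ _ e1; have [|h2'] := Rmult_integral _ _ e2; try lra;
  congr pair; lra.
Qed.

Lemma segment_rev p q t : segment p q t = segment q p (1 - t).
Proof. by rewrite /segment; f_equal; ring. Qed.

Hypothesis e_sym : symmetric e.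
Hypothesis e_axis : forall u v, e u v -> axis u != axis v.
Hypothesis pos_inj : injective (fun v => (axis v, neg v, mag v)).
(* Two edges in the same quadrant: nested, or sharing an endpoint. *)
Hypothesis mono : forall u v u' v', e u v -> e u' v' -> ~~ axis u -> ~~ axis u' ->
  neg u = neg u' -> neg v = neg v' -> (mag u < mag u')%N -> (mag v <= mag v')%N.

Lemma coord_inj u v : coord u = coord v -> neg u = neg v /\ mag u = mag v.
Proof.
rewrite /coord; have hu := pos_INR (mag u); have hv := pos_INR (mag v).
case: (neg u) (neg v) => -[] E; rewrite !S_INR in E; try (exfalso; lra);
  by split=> //; apply: INR_eq; lra.
Qed.

Lemma cross_pos_inj : injective cross_pos.
Proof.
move=> u v; rewrite /cross_pos => E; apply: pos_inj; move: E.
have := @coord_neq0 u; have := @coord_neq0 v.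
by case: (axis u); case: (axis v) => // nv nu [] //;
  try (move=> /coord_inj[-> ->] //); move=> *; exfalso; auto.
Qed.

(** A common point has equal projections on both axes, which puts the two edges in the same
    quadrant, where [mono] makes them nested or lets them share an endpoint. *)
Lemma cross_x u v u' v' s t : e u v -> e u' v' -> ~~ axis u -> ~~ axis u' -> (u, v) <> (u', v') ->
  0 < s < 1 -> 0 < t < 1 ->
  segment (cross_pos u) (cross_pos v) s <> segment (cross_pos u') (cross_pos v') t.
Proof.
move=> euv euv' au au' ne hs ht.
have av : axis v by move: (e_axis euv); rewrite (negPf au); case: (axis v).
have av' : axis v' by move: (e_axis euv'); rewrite (negPf au'); case: (axis v').
rewrite /cross_pos (negPf au) (negPf au') av av' /segment /= => -[h1 h2].
have {}h1 : (1 - s) * coord u = (1 - t) * coord u' by lra.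
have {}h2 : s * coord v = t * coord v' by lra.
have sg w w' a b : 0 < a -> 0 < b -> a * coord w = b * coord w' ->
    neg w = neg w' /\ a * INR (mag w).+1 = b * INR (mag w').+1.
  move=> a0 b0; rewrite /coord.
  have m1 : 0 < INR (mag w).+1 by apply: lt_0_INR; lia.
  have m2 : 0 < INR (mag w').+1 by apply: lt_0_INR; lia.
  have := Rmult_lt_0_compat _ _ a0 m1; have := Rmult_lt_0_compat _ _ b0 m2.
  by case: (neg w); case: (neg w') => *; split=> //; lra.
have [|| nu mu] := sg _ _ _ _ _ _ h1; try lra.
have [|| nv mv] := sg _ _ _ _ _ _ h2; try lra.
(* For nested edges the first equation forces x < y and the second one x >= y. *)
have main (a b a' b' : V) (x y : R) : 0 < x < 1 -> 0 < y < 1 ->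
    (1 - x) * INR (mag a).+1 = (1 - y) * INR (mag a').+1 ->
    x * INR (mag b).+1 = y * INR (mag b').+1 ->
    (mag a < mag a')%N -> (mag b <= mag b')%N -> False.
  move=> hx hy; rewrite !S_INR => E1 E2 /ltP/lt_INR l1 /leP/le_INR l2.
  have p1 := pos_INR (mag a); have p2 := pos_INR (mag b).
  have [xy|xy] := Rle_lt_dec y x.
    have : 0 < (1 - x) * (INR (mag a') - INR (mag a)) by apply: Rmult_lt_0_compat; lra.
    have : 0 <= (x - y) * (INR (mag a') + 1) by apply: Rmult_le_pos; lra.
    by lra.
  have : 0 < (y - x) * (INR (mag b) + 1) by apply: Rmult_lt_0_compat; lra.
  have : 0 <= y * (INR (mag b') - INR (mag b)) by apply: Rmult_le_pos; lra.
  by lra.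
have [lt|lt|E] := ltngtP (mag u) (mag u').
- by apply: (main u v u' v' s t) => //; exact: (mono euv euv').
- by apply: (main u' v' u v t s) => //; apply: (mono euv' euv).
have st : s = t.
  have k0 : INR (mag u').+1 <> 0 by rewrite S_INR; have := pos_INR (mag u'); lra.
  by rewrite E in mu; have := Rmult_eq_reg_r _ _ _ mu k0; lra.
have E' : mag v = mag v'.
  by apply: eq_add_S; apply: INR_eq; rewrite st in mv; apply: Rmult_eq_reg_l mv _; lra.
apply: ne; congr pair; apply: pos_inj.
  by rewrite (negPf au) (negPf au') nu E.
by rewrite av av' nv E'.
Qed.

Lemma cross_planar : planar e.
Proof.
exists cross_pos, (fun u v => segment (cross_pos u) (cross_pos v)).
have neq u v : e u v -> cross_pos u <> cross_pos v.
  by move=> euv /cross_pos_inj E; have := e_axis euv; rewrite E eqxx.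
split; first exact: cross_pos_inj.
split; first by move=> u v /neq; apply: segment_jordan.
split.
  (* Interior points of an edge have two non-zero coordinates, hence lie on neither axis. *)
  move=> u v w euv t ht; rewrite /segment /cross_pos.
  have := e_axis euv; have := @coord_neq0 u; have := @coord_neq0 v.
  by case: (axis u); case: (axis v) => //= nv nu _; case: (axis w) => -[]; nra.
move=> u v u' v' euv euv' ne s t hs ht.
have evu : e v u by rewrite e_sym.
have evu' : e v' u' by rewrite e_sym.
have ax a b : e a b -> axis a -> ~~ axis b.
  by move/e_axis; case: (axis a); case: (axis b).
case: (boolP (axis u)) => au; case: (boolP (axis u')) => au'.
(* Segments are reversed where necessary, so that both start on the horizontal axis. *)
- rewrite segment_rev [in X in _ <> X]segment_rev.
  apply: cross_x => //; try lra; [exact: ax euv au|exact: ax euv' au'|].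
  by case=> E1 E2; apply: ne; left.
- rewrite segment_rev; apply: cross_x => //; try lra; first exact: ax euv au.
  by case=> E1 E2; apply: ne; right.
- rewrite [in X in _ <> X]segment_rev; apply: cross_x => //; try lra; first exact: ax euv' au'.
  by case=> E1 E2; apply: ne; right.
by apply: cross_x => //; case=> E1 E2; apply: ne; left.
Qed.

End CrossDrawing.

Lemma planar_sub (V : finType) (e e' : rel V) :
  (forall u v, e' u v -> e u v) -> planar e -> planar e'.
Proof.
move=> sub [pos [c [pinj [arc [avoid cross]]]]]; exists pos, c; split => //.
split; first by move=> u v /sub/arc.
split; first by move=> u v w /sub; apply: avoid.
by move=> u v u' v' /sub h /sub; apply: cross.
Qed.

From mathcomp Require Import all_order all_algebra.
From mathcomp Require Import ring lra zify.
Import GRing.Theory Num.Theory.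

(** * Edge bound for bipartite planar graphs *)

Section BipartiteCirculation.
Local Open Scope ring_scope.
Variables (V : finType) (e : rel V).
Notation edge := {p : V * V | e p.1 p.2}.

Definition edge_inc (p : edge) (w : V) : rat :=
  ((val p).1 == w)%:R - ((val p).2 == w)%:R.

Definition edge_circ (z : edge -> rat) : Prop :=
  forall w, \sum_p z p * edge_inc p w = 0.

Lemma edge_circ_incident (z : edge -> rat) (p : edge) (w : V) :
  edge_circ z -> z p != 0 -> edge_inc p w != 0 ->
  exists q, [/\ q != p, z q != 0 & edge_inc q w != 0].
Proof.
move=> zc zp pw.
case: (pickP (fun q => [&& q != p, z q != 0 & edge_inc q w != 0])) => [q /and3P[]|no].
  by exists q.
have := zc w; rewrite (bigD1 p) //= big1 ?addr0; last first.
  by move=> q qp; have := no q; rewrite qp /=; case: eqP => [->|_]; rewrite ?mul0r //=;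
    case: eqP => // ->; rewrite mulr0.
by move/eqP; rewrite mulf_eq0 (negPf zp) (negPf pw).
Qed.

Variable col : V -> bool.
Hypothesis bip : forall u v, e u v -> ~~ col u && col v.

Lemma edge_inc_neq0 p w : (edge_inc p w != 0) = ((val p).1 == w) || ((val p).2 == w).
Proof.
rewrite /edge_inc; have /andP[c1 c2] := bip (valP p).
case: ((val p).1 =P w) => [<-|_] /=; case: ((val p).2 =P _) => [E|_] //=.
- by rewrite -E c2 in c1.
Qed.

(** No vertex meets exactly one edge of the support. From [p] this yields a second edge [q] at its
    tail, another one [r] at its head, and a further one [s] at the head of [q]; they are distinct
    because an edge is determined by its ends. *)
Lemma edge_circ_support (z : edge -> rat) :
  edge_circ z -> (exists p, z p != 0) -> (4 <= #|[pred p | z p != 0%R]|)%N.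
Proof.
move=> zc [p zp].
have bp (q : edge) : (~~ col (val q).1 && col (val q).2) by exact: bip (valP q).
have [q [qp zq]] : exists q, [/\ q != p, z q != 0 & (val q).1 == (val p).1].
  have [|q [qp zq]] := @edge_circ_incident z p (val p).1 zc zp.
    by rewrite edge_inc_neq0 eqxx.
  rewrite edge_inc_neq0 => /orP[|/eqP E]; first by exists q.
  by have := bp q; have := bp p; rewrite E; case: (col (val p).1); rewrite ?andbF.
move=> qp1.
have [r [rp zr]] : exists q, [/\ q != p, z q != 0 & (val q).2 == (val p).2].
  have [|r [rp zr]] := @edge_circ_incident z p (val p).2 zc zp.
    by rewrite edge_inc_neq0 eqxx orbT.
  rewrite edge_inc_neq0 => /orP[/eqP E|]; last by exists r.
  by have := bp r; have := bp p; rewrite E; case: (col (val p).2); rewrite ?andbF.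
move=> rp2.
have [s [sq zs]] : exists s, [/\ s != q, z s != 0 & (val s).2 == (val q).2].
  have [|s [sq zs]] := @edge_circ_incident z q (val q).2 zc zq.
    by rewrite edge_inc_neq0 eqxx orbT.
  rewrite edge_inc_neq0 => /orP[/eqP E|]; last by exists s.
  by have := bp s; have := bp q; rewrite E; case: (col (val q).2); rewrite ?andbF.
move=> sq2.
have neq2 : (val q).2 != (val p).2.
  apply: contra qp => /eqP E; apply/eqP/val_inj.
  by rewrite (surjective_pairing (val q)) (eqP qp1) E -surjective_pairing.
have rq : r != q by apply: contra neq2 => /eqP <-.
have sp : s != p by apply: contra neq2 => /eqP <-; rewrite eq_sym.
have sr : s != r by apply: contra neq2 => /eqP E; rewrite -(eqP sq2) E.
have U : uniq [:: p; q; r; s].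
  by rewrite /= !inE !negb_or (eq_sym p) qp (eq_sym p) rp (eq_sym p) sp (eq_sym q) rq
     (eq_sym q) sq (eq_sym r) sr.
have := card_uniqP U => /= <-; apply/subset_leq_card/subsetP => x.
by rewrite !inE => /or4P[] /eqP ->.
Qed.

Definition inc_mx : 'M[rat]_(#|{: edge}|, #|V|) :=
  \matrix_(i, j) edge_inc (enum_val i) (enum_val j).

(** Each row has one entry 1 and one entry -1, so the columns add up to zero. *)
Lemma rank_inc_mx : (0 < #|V|)%N -> (\rank inc_mx < #|V|)%N.
Proof.
move=> V0; rewrite ltn_neqAle rank_leq_col andbT; apply/negP => /eqP rk.
have : row_free inc_mx^T by rewrite /row_free mxrank_tr rk.
move/row_freeP => [X XE].
have : const_mx 1 *m inc_mx^T = 0 :> 'rV_(_).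
  apply/rowP => i; rewrite !mxE.
  under eq_bigr => j _ do rewrite !mxE mul1r /edge_inc.
  have S x : \sum_(i < #|V|) (x == enum_val i)%:R = 1 :> rat.
    rewrite (bigD1 (enum_rank x)) //= enum_rankK eqxx big1 ?addr0 // => j jx.
    by rewrite -(inj_eq enum_rank_inj) enum_valK eq_sym (negPf jx).
  rewrite sumrB.
  by rewrite !S subrr.
move/(congr1 (mulmx^~ X)); rewrite -mulmxA XE mulmx1 mul0mx.
move/rowP => /(_ (Ordinal V0)); rewrite !mxE => /eqP.
by rewrite oner_eq0.
Qed.

Lemma edge_bound (C : finType) (w : C -> edge -> rat) :
  (0 < #|V|)%N ->
  (forall c, edge_circ (w c)) ->
  (forall p, #|[pred c | w c p != 0%R]| <= 2)%N ->
  (forall z, edge_circ z -> exists f : C -> rat, forall p, z p = \sum_c f c * w c p) ->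
  (#|{: edge}| + 2 <= 2 * #|V|)%N.
Proof.
move=> V0 wc w2 wspan.
(* Zero circulations are discarded: the bound of four edges fails for them. *)
pose W := [pred c : C | [exists p, w c p != 0]].
(* Double counting of the pairs (c, p) with [w c p != 0]. *)
have W4 : (4 * #|W| <= 2 * #|{: edge}|)%N.
  rewrite mulnC -sum_nat_const mulnC -sum_nat_const.
  apply: (@leq_trans (\sum_(c in W) \sum_p (w c p != 0%R))).
    apply: leq_sum => c /existsP cW.
    have := edge_circ_support (wc c) cW; rewrite -sum1_card big_mkcond /=.
    by move/leq_trans; apply; apply: leq_sum => p _; rewrite inE; case: ifP.
  rewrite exchange_big /=; apply: leq_sum => p _.
  apply: leq_trans (w2 p); rewrite -sum1_card [X in (_ <= X)%N]big_mkcond /= [X in (X <= _)%N]big_mkcond /=.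
  by apply: leq_sum => c _; rewrite inE; case: ifP => //; case: (w c p == 0).
(* The kernel is the cycle space, so its dimension, at least E - V + 1, is at most the number of
   circulations in [W]. *)
have sub : (kermx inc_mx <= \matrix_(k < #|W|, j < #|{: edge}|) w (enum_val k) (enum_val j))%MS.
  apply/row_subP => i; set z := row i _.
  pose z' p := z 0 (enum_rank p).
  have [|f fE] := wspan z'.
    move=> v; have : z *m inc_mx = 0 by rewrite -row_mul mulmx_ker row0.
    move/rowP/(_ (enum_rank v)); rewrite mxE [RHS]mxE => zE; rewrite -[RHS]zE.
    rewrite (reindex_onto enum_val enum_rank) /=; last by move=> p _; rewrite enum_rankK.
    rewrite (eq_bigl xpredT); last by move=> j; rewrite enum_valK eqxx.
    by apply: eq_bigr => j _; rewrite /z' enum_valK; congr (_ * _); rewrite mxE enum_rankK.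
  apply/submxP; exists (\row_k f (enum_val k)); apply/rowP => j; rewrite [RHS]mxE.
  have := fE (enum_val j); rewrite /z' enum_valK => ->.
  under [RHS]eq_bigr => k _ do rewrite !mxE.
  rewrite -(big_enum_val (A := W) (fun c => f c * w c (enum_val j))) /=.
  rewrite [RHS]big_mkcond /=; apply: eq_bigr => c _; case: ifPn => //.
  by rewrite inE => /existsPn/(_ (enum_val j))/negPn/eqP ->; rewrite mulr0.
have := mxrankS sub; rewrite mxrank_ker => rk.
have := rank_leq_row (\matrix_(k < #|W|, j < #|{: edge}|) w (enum_val k) (enum_val j)).
have := rank_inc_mx V0.
by lia.
Qed.

End BipartiteCirculation.

(* A multigraph (G, D) on a closed surface: [lft d] and [rgt d] are the faces on the two sides of
   the edge [d].  The map [beta] contracts connected sets of nodes to the vertices of [e] and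
   deletes the nodes sent to [None].  Circulations need to be potential differences of faces only
   when they stay in [inner], so that the torus will qualify. *)
Section SphereMinor.
Local Open Scope ring_scope.
Variables (G C D V : finType) (src dst : D -> G) (lft rgt : D -> C).

Definition inc (d : D) (x : G) : rat := (src d == x)%:R - (dst d == x)%:R.
Definition circ (phi : D -> rat) : Prop := forall x, \sum_d phi d * inc d x = 0.

Variable inner : pred G.
Hypothesis face_circ : forall f : C -> rat, circ (fun d => f (lft d) - f (rgt d)).
Hypothesis circ_face : forall phi, circ phi ->
  (forall d, phi d != 0 -> inner (src d) && inner (dst d)) ->
  exists f : C -> rat, forall d, phi d = f (lft d) - f (rgt d).

Variable beta : G -> option V.
Definition link : rel G := fun x y =>
  [exists d, (src d == x) && (dst d == y) || (src d == y) && (dst d == x)].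
Definition branch_link (w : V) : rel G := fun x y =>
  [&& link x y, beta x == Some w & beta y == Some w].

Variable e : rel V.
Notation edge := {p : V * V | e p.1 p.2}.
Definition edge_witness (u v : V) (d : D) : bool :=
  (beta (src d) == Some u) && (beta (dst d) == Some v)
  || (beta (src d) == Some v) && (beta (dst d) == Some u).

Variable col : V -> bool.
Hypothesis bip : forall u v, e u v -> ~~ col u && col v.
Hypothesis beta_inner : forall x, beta x -> inner x.
Hypothesis branch_conn : forall w x y,
  beta x = Some w -> beta y = Some w -> connect (branch_link w) x y.
Variable base : V -> G.
Hypothesis beta_base : forall w, beta (base w) = Some w.
Hypothesis edge_ex : forall u v, e u v -> exists d, edge_witness u v d.

Definition rep (p : edge) : D := xchoose (edge_ex (valP p)).

Lemma rep_witness p : edge_witness (val p).1 (val p).2 (rep p).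
Proof. exact: xchooseP (edge_ex (valP p)). Qed.

Lemma edge_neq (p : edge) : (val p).1 != (val p).2.
Proof. by apply/eqP => E; have := bip (valP p); rewrite E andNb. Qed.

(** The branch sets at the ends of [rep p] give the two ends of [p], and the colouring tells which
    comes first. *)
Lemma rep_inj : injective rep.
Proof.
move=> p q E; have wp := rep_witness p; have := rep_witness q; rewrite -E => wq.
have /andP[p1 p2] := bip (valP p); have /andP[q1 q2] := bip (valP q).
apply/val_inj; rewrite [val p]surjective_pairing [val q]surjective_pairing.
move: wq; rewrite /edge_witness.
case/orP: wp => /andP[/eqP -> /eqP ->]; case/orP => /andP[/eqP[a] /eqP[b]];
  by rewrite ?a ?b // in p1 p2 *; rewrite ?p1 ?p2 in q1 q2.
Qed.

Definition branch_inc (d : D) (w : V) : rat :=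
  (beta (src d) == Some w)%:R - (beta (dst d) == Some w)%:R.

(* [rep p] may run from [(val p).2] to [(val p).1]; then the sign is [-1]. *)
Definition sgn (p : edge) : rat := branch_inc (rep p) (val p).1.

Lemma branch_inc_rep p w : branch_inc (rep p) w = sgn p * edge_inc p w.
Proof.
rewrite /sgn /branch_inc /edge_inc; have := edge_neq p.
case/orP: (rep_witness p) => /andP[/eqP -> /eqP ->]; rewrite !(inj_eq Some_inj) eqxx.
  by rewrite eq_sym => /negPf ->; rewrite subr0 mul1r.
by rewrite eq_sym => /negPf ->; rewrite sub0r mulN1r opprB.
Qed.

Lemma sgn_sq p : sgn p * sgn p = 1.
Proof.
rewrite /sgn /branch_inc; have := edge_neq p.
case/orP: (rep_witness p) => /andP[/eqP -> /eqP ->]; rewrite !(inj_eq Some_inj) eqxx.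
  by rewrite eq_sym => /negPf ->; rewrite subr0 mul1r.
by rewrite eq_sym => /negPf ->; rewrite sub0r mulN1r opprK.
Qed.

(* Deleting the edges that are not [used] merges the faces on their two sides. *)
Definition same_branch (d : D) : bool := beta (src d) && (beta (src d) == beta (dst d)).
Definition used (d : D) : bool := same_branch d || [exists p, rep p == d].

Lemma rep_diff_branch p : ~~ same_branch (rep p).
Proof.
rewrite /same_branch; have := edge_neq p.
by case/orP: (rep_witness p) => /andP[/eqP -> /eqP ->]; rewrite (inj_eq Some_inj) // eq_sym.
Qed.

Lemma branch_inc_same d w : same_branch d -> branch_inc d w = 0.
Proof. by case/andP => _ /eqP E; rewrite /branch_inc E subrr. Qed.

Lemma branch_inc_sum d w : branch_inc d w = \sum_(x | beta x == Some w) inc d x.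
Proof.
have S y : \sum_(x | beta x == Some w) (y == x)%:R = (beta y == Some w)%:R :> rat.
  case: (boolP (beta y == Some w)) => [b_y|nb].
    rewrite (bigD1 y) //= eqxx big1 ?addr0 // => x /andP[_].
    by rewrite eq_sym => /negPf ->.
  rewrite big1 // => x bx; case: eqP => // E.
  by rewrite E bx in nb.
by rewrite sumrB !S.
Qed.

Definition face_adj : rel C := fun a b => [exists d, ~~ used d &&
  ((lft d == a) && (rgt d == b) || (lft d == b) && (rgt d == a))].

Lemma face_adj_sym : connect_sym face_adj.
Proof.
apply: sym_connect_sym => a b; apply: eq_existsb => d.
by rewrite orbC.
Qed.

Definition face_of (a : C) : C := fingraph.root face_adj a.

Lemma face_of_unused d : ~~ used d -> face_of (lft d) = face_of (rgt d).
Proof.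
move=> ud; apply/(fingraph.rootP face_adj_sym)/connect1/existsP; exists d.
by rewrite ud !eqxx.
Qed.

(** The boundary of the merged face whose representative is [c]; it is zero if [c] represents no
    class. *)
Definition face_bd (c : C) (d : D) : rat :=
  (face_of (lft d) == c)%:R - (face_of (rgt d) == c)%:R.

Definition face_cycle (c : C) (p : edge) : rat := sgn p * face_bd c (rep p).

Lemma face_cycle_circ c : edge_circ (face_cycle c).
Proof.
move=> w.
have dv : \sum_d face_bd c d * branch_inc d w = 0.
  under eq_bigr => d _ do rewrite branch_inc_sum mulr_sumr.
  rewrite exchange_big /= big1 // => x _.
  exact: (face_circ (fun a => (face_of a == c)%:R) x).
rewrite -[RHS]dv (bigID (fun d => [exists p, rep p == d])) /= [X in _ = _ + X]big1 ?addr0; last first.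
  move=> d nr; case: (boolP (same_branch d)) => sb; first by rewrite branch_inc_same ?mulr0.
  by rewrite /face_bd face_of_unused ?subrr ?mul0r // /used negb_or sb.
rewrite (reindex_omap rep (fun d => [pick p | rep p == d])) /=; last first.
  move=> d /existsP[p /eqP <-]; by case: pickP => [q /eqP /= ->|/(_ p)] //; rewrite eqxx.
apply: eq_big => [p|p _].
  have -> : [exists q, rep q == rep p] by apply/existsP; exists p.
  by case: pickP => [q /eqP/rep_inj ->|/(_ p)]; rewrite eqxx.
by rewrite branch_inc_rep /face_cycle mulrAC mulrCA; ring.
Qed.

Lemma face_cycle_support p : (#|[pred c | face_cycle c p != 0%R]| <= 2)%N.
Proof.
apply: leq_trans (card_size [:: face_of (lft (rep p)); face_of (rgt (rep p))]).
apply/subset_leq_card/subsetP => c; rewrite !inE; apply: contraNT.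
rewrite negb_or /face_cycle /face_bd ![c == _]eq_sym => /andP[/negPf -> /negPf ->].
by rewrite subrr mulr0.
Qed.

Definition delta (x y : G) : rat := (x == y)%:R.

(** A unit flow from [x] to [y] along a path in the branch set. *)
Lemma branch_path w x y : beta x = Some w -> beta y = Some w ->
  exists phi : D -> rat, (forall z, \sum_d phi d * inc d z = delta x z - delta y z) /\
    forall d, ~~ same_branch d -> phi d = 0.
Proof.
move=> bx b_y; case/connectP: (branch_conn bx b_y) => s; elim: s x bx => [|x' s IH] x bx /=.
  move=> _ ->; exists (fun=> 0); split=> // z; rewrite subrr big1 // => d _.
  by rewrite mul0r.
case/andP => /and3P[/existsP[d0 d0P] _ /eqP bx'] ps ey.
have [phi [dphi sphi]] := IH _ bx' ps ey.
have [sg sgE] : exists sg : rat, forall z, sg * inc d0 z = delta x z - delta x' z.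
  case/orP: d0P => /andP[/eqP <- /eqP <-]; first by exists 1 => z; rewrite mul1r.
  by exists (- 1) => z; rewrite mulN1r opprB.
have sb0 : same_branch d0.
  by rewrite /same_branch; case/orP: d0P => /andP[/eqP -> /eqP ->]; rewrite bx bx' eqxx.
exists (fun d => phi d + (if d == d0 then sg else 0)); split=> [z|d nd]; last first.
  by rewrite sphi //; case: eqP => [E|]; rewrite ?addr0 //; rewrite E sb0 in nd.
under eq_bigr => d _ do rewrite mulrDl.
rewrite big_split /= dphi (bigD1 d0) //= eqxx sgE big1 ?addr0; first by rewrite addrC subrKA.
by move=> d /negPf ->; rewrite mul0r.
Qed.

(** The edge is lifted to a unit flow between base points: through the first branch set, across
    [rep p], then through the second one. *)
Lemma edge_path p : exists phi : D -> rat,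
  (forall z, \sum_d phi d * inc d z = delta (base (val p).1) z - delta (base (val p).2) z) /\
  forall d, ~~ same_branch d -> phi d = sgn p * (d == rep p)%:R.
Proof.
have [x [y [bx b_y xy]]] : exists x y, [/\ beta x = Some (val p).1, beta y = Some (val p).2 &
    forall z, sgn p * inc (rep p) z = delta x z - delta y z].
  have := edge_neq p; rewrite /sgn /branch_inc eq_sym => /negPf ne.
  case/orP: (rep_witness p) => /andP[/eqP b1 /eqP b2].
    exists (src (rep p)), (dst (rep p)); split => // z.
    by rewrite b1 b2 !(inj_eq Some_inj) eqxx ne subr0 mul1r.
  exists (dst (rep p)), (src (rep p)); split => // z.
  by rewrite b1 b2 !(inj_eq Some_inj) eqxx ne sub0r mulN1r opprB.
have [f [fd fs]] := branch_path (beta_base _) bx.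
have [g [gd gs]] := branch_path b_y (beta_base _).
exists (fun d => f d + g d + (if d == rep p then sgn p else 0)); split=> [z|d nd]; last first.
  by rewrite fs // gs // !add0r; case: eqP; rewrite ?mulr1 ?mulr0.
under eq_bigr => d _ do rewrite !mulrDl.
rewrite !big_split /= fd gd (bigD1 (rep p)) //= eqxx xy big1 ?addr0; first by ring.
by move=> d /negPf ->; rewrite mul0r.
Qed.

(** Superposing the lifts of the edges with weights [z] gives a circulation, since the net flow at
    each base point is the divergence of [z]. Its face potential supplies the coefficients. *)
Lemma edge_circ_span (z : edge -> rat) : edge_circ z ->
  exists f : C -> rat, forall p, z p = \sum_c f c * face_cycle c p.
Proof.
move=> zc.
have [path pathP] := fin_all_exists edge_path.
pose phi d := \sum_p z p * path p d.
have phi0 d : ~~ same_branch d -> phi d = \sum_p z p * (sgn p * (d == rep p)%:R).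
  by move=> nd; apply: eq_bigr => p _; rewrite (pathP p).2.
have phi_rep p : phi (rep p) = sgn p * z p.
  rewrite phi0 ?rep_diff_branch // (bigD1 p) //= eqxx mulr1 mulrC big1 ?addr0 // => q.
  by rewrite -(inj_eq rep_inj) eq_sym => /negPf ->; rewrite !mulr0.
have phi_unused d : ~~ used d -> phi d = 0.
  rewrite negb_or => /andP[nb /existsPn nr]; rewrite phi0 // big1 // => p _.
  by have := nr p; rewrite eq_sym => /negPf ->; rewrite !mulr0.
have phic : circ phi.
  move=> x; under eq_bigr => d _ do rewrite mulr_suml.
  rewrite exchange_big /=.
  transitivity (\sum_p \sum_w z p * edge_inc p w * delta (base w) x).
    apply: eq_bigr => p _.
    under eq_bigr => d _ do rewrite -mulrA.
    rewrite -mulr_sumr (pathP p).1.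
    under eq_bigr => w _ do rewrite -mulrA.
    rewrite -mulr_sumr; congr (_ * _).
    under eq_bigr => w _ do rewrite mulrBl.
    rewrite sumrB (bigD1 (val p).1) //= eqxx mul1r big1 ?addr0; last first.
      by move=> w; rewrite eq_sym => /negPf ->; rewrite mul0r.
    rewrite (bigD1 (val p).2) //= eqxx mul1r big1 ?addr0 //.
    by move=> w; rewrite eq_sym => /negPf ->; rewrite mul0r.
  rewrite exchange_big big1 //= => w _.
  by rewrite -mulr_suml zc mul0r.
have [|f fE] := circ_face phic.
  move=> d nz; have : used d by apply: contraNT nz => /phi_unused ->.
  case/orP => [/andP[b /eqP E]|/existsP[p /eqP <-]].
    by rewrite !beta_inner // -E.
  by case/orP: (rep_witness p) => /andP[/eqP b1 /eqP b2]; rewrite !beta_inner // ?b1 ?b2.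
have fconst a : f (face_of a) = f a.
  have := connect_root face_adj a; rewrite -/(face_of a) => /connectP[s].
  elim: s a (face_of a) => [|b s IH] a c /=; first by move=> _ ->.
  case/andP => /existsP[d /andP[ud dP]] ps el; rewrite (IH _ _ ps el).
  have := fE d; rewrite phi_unused // => /esym/eqP; rewrite subr_eq0 => /eqP.
  by case/orP: dP => /andP[/eqP -> /eqP ->].
exists f => p; rewrite -[LHS]mul1r -(sgn_sq p) -mulrA -phi_rep fE -(fconst (lft _)) -(fconst (rgt _)).
have S a : f a = \sum_c f c * (a == c)%:R.
  rewrite (bigD1 a) //= eqxx mulr1 big1 ?addr0 // => c.
  by rewrite eq_sym => /negPf ->; rewrite mulr0.
rewrite [f (face_of (lft _))]S [f (face_of (rgt _))]S -sumrB mulr_sumr.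
by apply: eq_bigr => c _; rewrite /face_cycle /face_bd; ring.
Qed.

Lemma sphere_minor_bound : (0 < #|V|)%N -> (#|{: edge}| + 2 <= 2 * #|V|)%N.
Proof.
move=> V0; exact: (edge_bound bip V0 face_cycle_circ face_cycle_support edge_circ_span).
Qed.

End SphereMinor.

(* The grid with periodic boundary conditions: the first component of a dart is its direction
   (true for vertical), the second one its source, which also names the cell above and to the
   right of it. *)
Section Torus.
Local Open Scope ring_scope.
Variable N : nat.
Notation node := ('I_N.+1 * 'I_N.+1)%type.
Notation dart := (bool * node)%type.

Definition tsrc (d : dart) : node := d.2.
Definition tdst (d : dart) : node :=
  if d.1 then (d.2.1, ordS d.2.2) else (ordS d.2.1, d.2.2).
Definition tlft (d : dart) : node := if d.1 then (ord_pred d.2.1, d.2.2) else d.2.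
Definition trgt (d : dart) : node := if d.1 then d.2 else (d.2.1, ord_pred d.2.2).

Lemma torus_div (phi : dart -> rat) (x : node) :
  \sum_d phi d * inc tsrc tdst d x =
  phi (false, x) + phi (true, x) - phi (false, (ord_pred x.1, x.2))
  - phi (true, (x.1, ord_pred x.2)).
Proof.
rewrite /inc.
under eq_bigr => d _ do rewrite mulrBr.
rewrite sumrB.
have S1 : \sum_d phi d * (tsrc d == x)%:R = phi (true, x) + phi (false, x).
  rewrite (bigD1 (true, x)) //= (bigD1 (false, x)) //= /tsrc /= eqxx !mulr1 big1 ?addr0 //.
  case=> b y /andP[]; rewrite /= !xpair_eqE.
  by case: (y == x); case: b => //=; rewrite ?mulr0.
have S2 : \sum_d phi d * (tdst d == x)%:R =
    phi (true, (x.1, ord_pred x.2)) + phi (false, (ord_pred x.1, x.2)).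
  rewrite (bigD1 (true, (x.1, ord_pred x.2))) //= (bigD1 (false, (ord_pred x.1, x.2))) //=.
  rewrite /tdst /= !ord_predK -!surjective_pairing eqxx !mulr1 big1 ?addr0 //.
  case=> b [i j] /andP[]; rewrite /= !xpair_eqE; case: x {S1} => x1 x2 /=.
  case: b; rewrite /= !xpair_eqE ?andbT.
    move=> H _; rewrite (can2_eq (@ordSK _) (@ord_predK _)).
    by rewrite (negPf H) mulr0.
  move=> _ H; rewrite (can2_eq (@ordSK _) (@ord_predK _)).
  by rewrite (negPf H) mulr0.
by rewrite S1 S2; ring.
Qed.

Lemma torus_face_circ (f : node -> rat) : circ tsrc tdst (fun d => f (tlft d) - f (trgt d)).
Proof. by move=> [i j]; rewrite torus_div /tlft /trgt /=; ring. Qed.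

Lemma torus_circ_face (phi : dart -> rat) : circ tsrc tdst phi ->
  (forall d, phi d != 0 -> grid_inner (tsrc d) && grid_inner (tdst d)) ->
  exists f : node -> rat, forall d, phi d = f (tlft d) - f (trgt d).
Proof.
move=> phic phi_in.
have phi0 d : ~~ (grid_inner (tsrc d) && grid_inner (tdst d)) -> phi d = 0.
  by move=> nd; apply/eqP; apply: contraNT nd => /phi_in.
have cons i j := phic (i, j).
(* the flow through the horizontal edges below the cell [x], starting from row 0 *)
pose f (x : node) := \sum_(k < N.+1 | (k <= x.2)%N) phi (false, (x.1, k)).
have f0 i : f (i, ord0) = phi (false, (i, ord0)).
  rewrite /f (bigD1 ord0) //= big1 ?addr0 // => k.
  by rewrite leqn0 -(inj_eq val_inj) /= => /andP[/eqP-> ]; rewrite eqxx.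
have predS (j : 'I_N.+1) : (0 < j)%N -> ord_pred j = j.-1 :> nat.
  by case: j => [[|k] Hk] // _; rewrite /= modnDr modn_small // ltnW.
have fS i (j : 'I_N.+1) : (0 < j)%N -> f (i, j) = f (i, ord_pred j) + phi (false, (i, j)).
  move=> j0; rewrite /f (bigD1 j) //= addrC; congr (_ + _); apply: eq_bigl => k.
  have := predS _ j0; rewrite -(inj_eq val_inj) /= => ->.
  by case: j j0 => [[|j] Hj] //= _; apply/idP/idP; lia.
(* Induction on the row, by conservation at (i, j); in row 0 the vertical edge entering from below
   wraps around and carries no flow. *)
have horT i j : f (ord_pred i, j) - f (i, j) = phi (true, (i, j)).
  have [n] := ubnP (j : nat); elim: n j => // n IH j ltj.
  have c := cons i j; rewrite torus_div /= in c.
  have [j0|j0] := posnP j; last first.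
    have := IH (ord_pred j); have -> : (ord_pred j < n)%N by rewrite predS //; lia.
    by rewrite !(fS _ j) // => h; lra.
  have -> : j = ord0 by apply/val_inj.
  rewrite !f0; rewrite (_ : j = ord0) in c; last by apply/val_inj.
  have z : phi (true, (i, ord_pred ord0)) = 0.
    by apply: phi0; rewrite /tdst [_.1]/= ord_predK /grid_inner /= ltnn !andbF.
  by rewrite z in c; lra.
(* The top cells lie below the edges of row 0, so [f] must vanish there. It is constant along the
   top row because the vertical edges between these cells wrap around, and it is zero in column 0,
   where nothing flows. *)
have fmax i : f (i, ord_max) = 0.
  have shift k : f (ord_pred k, ord_max) = f (k, ord_max).
    have := horT k ord_max; rewrite phi0; first by move/eqP; rewrite subr_eq0 => /eqP.
    by rewrite /grid_inner /= modnn ltnn !andbF.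
  have [n] := ubnP (i : nat); elim: n i => // n IH i lti.
  have [i0|i0] := posnP i; last by rewrite -shift IH // predS //; lia.
  by rewrite /f big1 // => k _; apply: phi0; rewrite /grid_inner /= i0.
exists f => -[[] [i j]]; rewrite /tlft /trgt /=; first by rewrite horT.
have [j0|j0] := posnP j; last by rewrite fS //; ring.
have -> : j = ord0 by apply/val_inj.
rewrite f0 (_ : ord_pred ord0 = ord_max) ?fmax ?subr0 //.
by apply/val_inj; rewrite /= modn_small.
Qed.

End Torus.

(** * From a grid drawing to a minor of the torus *)

Lemma path_trim (T : eqType) (r : rel T) (P Q : pred T) (a : T) (s : seq T) :
  (forall x, P x -> ~~ Q x) -> path r a s -> P a -> Q (last a s) ->
  exists a' s' b', [/\ P a', Q b', path r a' (rcons s' b'),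
    all [predC [predU P & Q]] s' & {subset rcons (a' :: s') b' <= a :: s}].
Proof.
move=> PQ ps Pa Ql.
pose good x t := exists a' s' b', [/\ P a', Q b', path r a' (rcons s' b'),
    all [predC [predU P & Q]] s' & {subset rcons (a' :: s') b' <= x :: t}].
(* The piece sought runs from the last visit to [P] before the first visit to [Q]. In the induction
   the start need not be in [P]; the second alternative covers the case that [P] is not met
   again. *)
suff [//|[s' [b' [h1 h2 h3 h4]]]] : good a s \/ exists s' b',
    [/\ Q b', path r a (rcons s' b'), all [predC [predU P & Q]] s' &
        {subset rcons (a :: s') b' <= a :: s}].
  by exists a, s', b'.
have {Pa} : ~~ Q a by exact: PQ.
elim: s a ps Ql => [|x s IH] a /=; first by move=> _ ->.
case/andP=> rax ps Ql nQa; case: (boolP (Q x)) => [Qx|nQx].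
  right; exists [::], x; split=> //=; first by rewrite rax.
  by move=> y; rewrite !inE => /orP[->|->] //; rewrite orbT.
have sub t : {subset t <= x :: s} -> {subset t <= [:: a, x & s]}.
  by move=> h y /h; rewrite [in X in _ -> X]inE orbC => ->.
case: (IH x ps Ql nQx) => [[a' [s' [b' [h1 h2 h3 h4 h5]]]]|[s' [b' [h1 h2 h3 h4]]]].
  by left; exists a', s', b'; split => //; apply: sub.
case: (boolP (P x)) => [Px|nPx].
  by left; exists x, s', b'; split => //; apply: sub.
right; exists (x :: s'), b'; split => //=; first by rewrite rax.
  by rewrite h3 andbT negb_or nPx.
move=> y; rewrite inE => /orP[/eqP->|]; first by rewrite inE eqxx.
exact: sub.
Qed.

Section GridModel.
Variables (V : finType) (e : rel V) (col : V -> bool) (N : nat).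
Notation node := ('I_N.+1 * 'I_N.+1)%type.
Notation edge := {p : V * V | e p.1 p.2}.

Lemma grid_step_link (x y : node) : grid_step x y -> link (@tsrc N) (@tdst N) x y.
Proof.
case: x y => [i j] [i' j']; rewrite /grid_step /=.
have S (k l : 'I_N.+1) : k.+1 == l -> ordS k = l.
  by move=> /eqP E; apply/val_inj; rewrite /= E modn_small.
case/or4P=> /andP[E1 E2]; apply/existsP.
- by exists (false, (i, j)); rewrite /tsrc /tdst /= (S _ _ E1) (eqP E2) !eqxx.
- by exists (false, (i', j')); rewrite /tsrc /tdst /= (S _ _ E1) (eqP E2) !eqxx orbT.
- by exists (true, (i, j)); rewrite /tsrc /tdst /= (S _ _ E2) (eqP E1) !eqxx.
- by exists (true, (i', j')); rewrite /tsrc /tdst /= (S _ _ E2) (eqP E1) !eqxx orbT.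
Qed.

Hypothesis bip : forall u v, e u v -> ~~ col u && col v.
Variables (B : V -> pred node) (W : V -> V -> pred node).
Hypothesis drawing : grid_drawing e B W.

Lemma trimmed_walk (p : edge) : exists t : node * seq node * node,
  let: (a, s, b) := t in
  [/\ B (val p).1 a, B (val p).2 b, path (@grid_step N) a (rcons s b),
      forall x, x \in s -> ~~ B (val p).1 x && ~~ B (val p).2 x &
      forall x, x \in s -> W (val p).1 (val p).2 x].
Proof.
have ep := valP p; case: (val p) ep => u v /= ep.
have [a [b [Ba Bb Wa /connectP[s ps eb]]]] := walk_conn drawing ep.
have uv x : B u x -> ~~ B v x.
  move=> Bux; apply/negP => Bvx; have := bip ep.
  by rewrite (ball_disj drawing Bux Bvx) andNb.
have [|a' [s' [b' [h1 h2 h3 h4 h5]]]] := path_trim uv ps Ba; first by rewrite -eb.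
exists (a', s', b'); split=> //.
- by apply: sub_path h3 => x y /and3P[].
- by move=> x /(allP h4); rewrite /= negb_or.
move=> x xs; have : x \in a :: s by apply: h5; rewrite mem_rcons !inE xs !orbT.
have : all (W u v) (a :: s).
  rewrite /= Wa /=; elim: (s) (a) ps => //= y t IH z /andP[/and3P[_ _ ->] /IH ->] //.
by move/allP => h /h.
Qed.

Lemma grid_model_bound : (0 < #|V|) -> #|{: edge}| + 2 <= 2 * #|V|.
Proof.
move=> V0; have [walk walkP] := fin_all_exists trimmed_walk.
pose inside p := (walk p).1.2.
have sB (p : edge) x w : x \in inside p -> ~~ B w x.
  have := walkP p; rewrite /inside; case: (walk p) => [[a s] b] /= [_ _ _ h1 h2] xs.
  apply/negP => Bw; case: (walk_ball drawing (valP p) (h2 _ xs) Bw) => E; rewrite E in Bw;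
    by have := h1 _ xs; rewrite Bw ?andbF.
have sW (p : edge) x : x \in inside p -> W (val p).1 (val p).2 x.
  by have := walkP p; rewrite /inside; case: (walk p) => [[a s] b] /= [_ _ _ h1 h2]; apply: h2.
have s_inj (p q : edge) x : x \in inside p -> x \in inside q -> p = q.
  move=> xp xq; apply/eqP; apply/negPn/negP => pq.
  have ne : ((val p).1, (val p).2) <> ((val q).1, (val q).2).
    rewrite -!surjective_pairing => E; by move/eqP: pq; apply; apply/val_inj.
  have := walk_walk drawing (valP p) (valP q) ne (sW _ _ xp) (sW _ _ xq).
  by rewrite !(negPf (sB _ _ _ xp)).
(* The branch set of [w] is its ball together with the inner nodes of the trimmed walks of the edges
   that start at [w]. *)
pose beta x := if [pick w | B w x] is Some w then Some w else
  if [pick p | x \in inside p] is Some p then Some (val p).1 else None.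
have betaB w x : B w x -> beta x = Some w.
  move=> Bw; rewrite /beta; case: pickP => [w' Bw'|/(_ w)]; last by rewrite Bw.
  by rewrite (ball_disj drawing Bw Bw').
have betaS (p : edge) x : x \in inside p -> beta x = Some (val p).1.
  move=> xp; rewrite /beta; case: pickP => [w|_]; first by rewrite (negPf (sB _ _ _ xp)).
  by case: pickP => [q xq|/(_ p)]; [rewrite (s_inj _ _ _ xp xq)|rewrite xp].
have betaE x w : beta x = Some w -> B w x \/ exists2 p : edge, x \in inside p & w = (val p).1.
  rewrite /beta; case: pickP => [w' Bw [<-]|_]; first by left.
  by case: pickP => // p xp [<-]; right; exists p.
pose bl := branch_link (@tsrc N) (@tdst N) beta.
have bl_sym w : connect_sym (bl w).
  apply: sym_connect_sym => x y; rewrite /bl /branch_link; congr (_ && _); last exact: andbC.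
  by apply: eq_existsb => d; exact: orbC.
have B_bl w x y : B w x -> B w y -> connect (bl w) x y.
  move=> Bx By; apply: connect_sub (ball_conn drawing Bx By) => a b /and3P[ab Ba Bb].
  by apply/connect1/and3P; split; rewrite ?(betaB _ _ Ba) ?(betaB _ _ Bb) //; exact: grid_step_link.
have to_B w x : beta x = Some w -> exists2 y, B w y & connect (bl w) y x.
  case/betaE => [Bx|[p xp ->]]; first by exists x; rewrite ?connect0.
  have := walkP p; have := betaS p; move: xp; rewrite /inside.
  case: (walk p) => [[a s] b] /= xs bS [Ba _ ps _ _]; exists a => //.
  have {}ps : path (bl (val p).1) a s.
    move: ps; rewrite rcons_path => /andP[ps _].
    have [A1 A2] : beta a = Some (val p).1 /\ all (fun x => beta x == Some (val p).1) s.
      by split; [exact: betaB|apply/allP => z /bS ->].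
    elim: (s) (a) ps A1 A2 => //= z t IH c /andP[cz pt] bc /andP[/eqP bz bt].
    by rewrite IH // andbT; apply/and3P; split; rewrite ?bc ?bz //; exact: grid_step_link.
  by apply: (path_connect ps); rewrite inE xs orbT.
have [base baseP] := fin_all_exists (ball_ex drawing).
apply: (@sphere_minor_bound _ _ _ V (@tsrc N) (@tdst N) (@tlft N) (@trgt N) (@grid_inner N)
  (@torus_face_circ N) (@torus_circ_face N) beta e col bip _ _ base _ _ V0).
- move=> x; case E: (beta x) => [w|//] _; case/betaE: E => [|[p xp _]]; first by move/(ball_inner drawing).
  exact: (walk_inner drawing (valP p) (sW _ _ xp)).
- move=> w x y /to_B[x' Bx' cx] /to_B[y' By' cy].
  apply: connect_trans (connect_trans (B_bl _ _ _ Bx' By') cy).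
  by rewrite bl_sym.
- by move=> w; apply: betaB.
move=> u v uv; pose p : edge := exist _ (u, v) uv.
have := walkP p; have := betaS p; rewrite /inside.
case: (walk p) => [[a s] b] /= bS [Ba Bb]; rewrite rcons_path => /andP[_ lk] _ _.
(* The last step of the trimmed walk goes from the branch set of [u] into the ball of [v], and so
   witnesses the edge. *)
have bl_ : beta (last a s) = Some u.
  by have := mem_last a s; rewrite inE => /orP[/eqP ->|/bS]; [exact: betaB|].
case/existsP: (grid_step_link lk) => d dP; exists d; rewrite /edge_witness.
by case/orP: dP => /andP[/eqP -> /eqP ->]; rewrite bl_ (betaB _ _ Bb) !eqxx ?orbT.
Qed.

End GridModel.

Lemma planar_bip_bound (V : finType) (e : rel V) (col : V -> bool) :
  0 < #|V| -> (forall u v, e u v -> ~~ col u && col v) -> planar e ->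
  #|[pred p : V * V | e p.1 p.2]| + 2 <= 2 * #|V|.
Proof.
move=> V0 bip /(planar_grid bip)[N [B [W dr]]].
by have := grid_model_bound bip dr V0; rewrite card_sig.
Qed.

(** * The decomposition *)

Section Blowup.
Variable n : nat.
Notation vert := (('I_3 * 'I_n) * bool)%type.
Notation graph := (kron (Knnn n) K2).

(* K_3 x K_2 is a 6-cycle: by the Chinese remainder theorem, [part v] is the number in 0..5
   congruent to v.1.1 mod 3 and to v.2 mod 2. *)
Definition part (v : vert) : nat := (4 * v.1.1 + 3 * v.2) %% 6.
Definition idx (v : vert) : nat := v.1.2.
Notation p := n./2.

Lemma part_lt v : part v < 6. Proof. by rewrite ltn_mod. Qed.
Lemma idx_lt v : idx v < n. Proof. exact: ltn_ord. Qed.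
(** The value [2 * p] is attained for odd [n] only, by the leftover vertices c_i. *)
Lemma idx_le v : idx v <= 2 * p. Proof. have := idx_lt v; lia. Qed.

Lemma part_idx_inj u v : part u = part v -> idx u = idx v -> u = v.
Proof.
case: u v => [[i j] b] [[i' j'] b'] /= P /val_inj /= J.
suff [-> ->] : i = i' /\ b = b' by rewrite J.
by move: P; rewrite /part /=; case: b b' => -[]; case: i => [[|[|[|//]]] hi];
  case: i' => [[|[|[|//]]] hi'] //= _; split=> //; apply: val_inj.
Qed.

Lemma graph_part u v : graph u v = ((part u).+1 %% 6 == part v) || ((part v).+1 %% 6 == part u).
Proof.
case: u v => [[i j] b] [[i' j'] b']; rewrite /kron /Knnn /K2 /part /= -(inj_eq val_inj) /=.
by case: b b' => -[]; case: i => [[|[|[|//]]] hi]; case: i' => [[|[|[|//]]] hi'].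
Qed.

Section Layer.
Variable r : nat.

(* The levels, from the centre outwards: c_5, P_0, V_1, ..., V_5, V_0, the odd ones on the vertical
   axis.  A pair comes last in its level, one vertex on each half-axis; all other vertices are on
   the positive half.  Edges go from the vertices in [top] to the next level. *)
Definition level (v : vert) : nat :=
  if (part v == 5) && (idx v == 2 * p) then 0
  else if part v == 0 then (if (idx v)./2 == r then 1 else 7) else (part v).+1.
Definition top (v : vert) : bool := ((idx v)./2 == r) || (level v == 0).
Definition layer : rel vert := fun u v =>
  top u && (level v == (level u).+1) || top v && (level u == (level v).+1).
(** Levels occupy disjoint blocks of length n + 1. Both vertices of a pair get the last place n,
    being told apart by their half-axes. *)
Definition layer_mag (v : vert) : nat := level v * n.+1 + (if top v then n else idx v).

Lemma layer_sym : symmetric layer.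
Proof. by move=> u v; rewrite /layer orbC. Qed.

Lemma layer_mag_lt u v : layer_mag u < layer_mag v ->
  level u < level v \/ level u = level v /\ ~~ top u.
Proof.
rewrite /layer_mag; have := idx_lt u; have := idx_lt v => iv iu.
case: (ltngtP (level u) (level v)) => [|lt|->]; first by left.
  have := leq_mul2r n.+1 (level v).+1 (level u); rewrite lt orbT mulSn.
  by case: (top u); case: (top v); lia.
rewrite ltn_add2l; case: (top u) => //; last by right.
by case: (top v) => [|]; [rewrite ltnn|lia].
Qed.

Lemma layer_mag_le u v : level u < level v \/ level u = level v /\ top v ->
  layer_mag u <= layer_mag v.
Proof.
rewrite /layer_mag; have := idx_lt u; have := idx_lt v => iv iu.
case=> [lt|[-> ->]]; last by case: (top u); lia.
have := leq_mul2r n.+1 (level u).+1 (level v); rewrite lt orbT mulSn.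
by case: (top u); case: (top v); lia.
Qed.

Lemma layer_inj : injective (fun v => (odd (level v), odd (idx v) && top v && (level v != 0), layer_mag v)).
Proof.
move=> u v [_ sg mg].
have lv : level u = level v.
  have iu := idx_lt u; have iv := idx_lt v.
  move: mg; rewrite /layer_mag; case: (ltngtP (level u) (level v)) => // lt.
    have := leq_mul2r n.+1 (level u).+1 (level v); rewrite lt orbT mulSn.
    by case: (top u); case: (top v); lia.
  have := leq_mul2r n.+1 (level v).+1 (level u); rewrite lt orbT mulSn.
  by case: (top u); case: (top v); lia.
have pe : part u = part v.
  move: lv; rewrite /level; have := part_lt u; have := part_lt v.
  by do ?case: ifP => ?; lia.
apply: part_idx_inj => //.
have iu := idx_lt u; have iv := idx_lt v.
move: mg sg; rewrite /layer_mag lv => /addnI.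
have [l0|l0] := eqVneq (level v) 0.
  move=> _ _; rewrite l0 in lv; move: lv l0; rewrite /level.
  by do ?case: ifP => ?; lia.
case: ifP => tu; case: ifP => tv; rewrite ?andbT ?andbF //; try lia.
by move: tu tv; rewrite /top lv (negPf l0) !orbF; lia.
Qed.

(** Edges join consecutive levels, and only [top] vertices, the outermost of their level, have
    neighbours further out. Comparing two levels of equal parity then gives the nesting. *)
Lemma layer_planar : planar layer.
Proof.
apply: (@cross_planar _ _ _ _ _ layer_sym _ layer_inj).
  by move=> u v; rewrite /layer => /orP[] /andP[_ /eqP ->] /=; case: (odd _).
move=> u v u' v' uv uv' au au' _ _ /layer_mag_lt H; apply: layer_mag_le.
have par : odd (level u) = odd (level u') by rewrite (negPf au) (negPf au').
case/orP: uv => /andP[t1 /eqP l1]; case/orP: uv' => /andP[t2 /eqP l2];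
  case: H => [H|[H /negP nt]] //; rewrite ?t2; lia.
Qed.
End Layer.

(* From the centre outwards: V_4 (positive) and c_0, V_2, V_0 (negative) on the horizontal axis;
   V_1, V_3, even half of V_5 (positive) and c_5, odd half of V_5 (negative) on the vertical one. *)
Definition last_neg (v : vert) : bool :=
  if part v == 5 then (idx v == 2 * p) || odd (idx v) else (part v == 0) || (part v == 2).
Definition last_mag (v : vert) : nat :=
  n * (match part v with
       | 0 => if idx v == 2 * p then 0 else 2
       | 1 => 0
       | 2 => 1
       | 3 => 1
       | 4 => 0
       | _ => if idx v == 2 * p then 0 else 2
       end) + idx v.
(** Each arc is listed with its even part first. The equality of halves covers P_0-P_5 and also
    c_0-c_5, whose halves are both [p]. *)
Definition last_arc (u v : vert) : bool :=
  match part u, part v with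
  | 0, 1 => idx u == 2 * p
  | 2, 1 => idx v == 2 * p
  | 2, 3 => idx u == 2 * p
  | 4, 3 => idx v == 2 * p
  | 4, 5 => (idx u == 2 * p) || (idx v == 2 * p)
  | 0, 5 => (idx u)./2 == (idx v)./2
  | _, _ => false
  end.
Definition last_layer : rel vert := fun u v => last_arc u v || last_arc v u.

Lemma last_planar : planar last_layer.
Proof.
apply: (@cross_planar _ _ (fun v => odd (part v)) last_neg last_mag).
- by move=> u v; rewrite /last_layer orbC.
- by move=> u v /orP[]; rewrite /last_arc; case: (part u) => [|[|[|[|[|[|k]]]]]];
    case: (part v) => [|[|[|[|[|[|l]]]]]].
- move=> u v [o s m]; move: o s m; rewrite /last_neg /last_mag => o s m.
  have := part_lt u; have := part_lt v; have := idx_lt u; have := idx_lt v.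
  move=> h1 h2 h3 h4; suff : part u = part v /\ idx u = idx v by case; apply: part_idx_inj.
  move: (part u) (part v) h3 h4 o s m => a b.
  case: a => [|[|[|[|[|[|a]]]]]]; case: b => [|[|[|[|[|[|b]]]]]] //= _ _;
    do ?case: ifP => ?; move=> *; lia.
move=> u v u' v'; rewrite /last_layer /last_arc /last_neg /last_mag.
have := idx_lt u; have := idx_lt v; have := idx_lt u'; have := idx_lt v'.
have := part_lt u; have := part_lt v; have := part_lt u'; have := part_lt v'.
move: (part u) (part v) (part u') (part v') => a b a' b'.
move: (idx u) (idx v) (idx u') (idx v') => i j i' j'.
case: a => [|[|[|[|[|[|a]]]]]]; case: b => [|[|[|[|[|[|b]]]]]] //=;
  case: a' => [|[|[|[|[|[|a']]]]]]; case: b' => [|[|[|[|[|[|b']]]]]] //= _ _ _ _;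
  rewrite ?andbT ?andbF ?orbF; do ?case: ifP => ?; move=> *; lia.
Qed.

Lemma blowup_cover u v : (part u).+1 %% 6 = part v ->
  last_layer u v \/ exists2 r, r < p & layer r u v.
Proof.
move=> uv.
have [l|nl] := boolP (last_layer u v); first by left.
right.
have := part_lt u; have := part_lt v; have := idx_le u; have := idx_le v.
(* The layer is that of the pair of [u]. If [u] is some c_i, the only edges outside the last layer
   are c_5-P_0, found in the layer of the pair of [v]. *)
pose r := if idx u == 2 * p then (idx v)./2 else (idx u)./2.
move=> iu iv pu pv; suff [] : r < p /\ layer r u v by exists r.
move: nl; rewrite /last_layer /last_arc /layer /top /level /r.
move: (part u) (part v) (idx u) (idx v) uv iu iv pu pv => a b i j.
case: a => [|[|[|[|[|[|a]]]]]]; case: b => [|[|[|[|[|[|b]]]]]] //= _ ji ii _ _;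
  do ?case: ifP => ?; rewrite ?andbT ?andbF ?orbF ?orbT ?eqxx //=; move=> *; lia.
Qed.

Lemma blowup_decomp : planar_decomp graph (uphalf n.+1).
Proof.
exists (fun i u v => graph u v && (if (i : nat) < p then layer i u v else last_layer u v)).
split; first by move=> i u v /andP[].
split.
  move=> i; pose F u v := if (i : nat) < p then layer i u v else last_layer u v.
  apply: (@planar_sub _ F); first by move=> u v /andP[].
  by rewrite /F; case: (_ < _); [exact: layer_planar|exact: last_planar].
(* There are [p] layers of pairs, and index [p] is the extra one. *)
have K : uphalf n.+1 = p.+1 by lia.
have cov u v : (part u).+1 %% 6 = part v -> exists i : 'I_(uphalf n.+1),
    if (i : nat) < p then layer i u v else last_layer u v.
  case/blowup_cover => [l|[r rp l]].
    have pk : p < uphalf n.+1 by rewrite K.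
    by exists (Ordinal pk); rewrite /= ltnn.
  have rk : r < uphalf n.+1 by rewrite K ltnW.
  by exists (Ordinal rk); rewrite /= rp.
move=> u v g; suff [i ci] : exists i : 'I_(uphalf n.+1),
    if (i : nat) < p then layer i u v else last_layer u v.
  by exists i; apply/andP.
move: g; rewrite graph_part => /orP[] /eqP /cov[i ci]; exists i => //.
by move: ci; case: ifP => _; [rewrite layer_sym|rewrite /last_layer orbC].
Qed.

End Blowup.

(** * The thickness *)

Section LowerBound.
Variable n : nat.
Notation vert := (('I_3 * 'I_n) * bool)%type.
Notation graph := (kron (Knnn n) K2).

(** Each edge is counted once, oriented from the false copy to the true one. *)
Definition arcs : pred (vert * vert) := fun x => graph x.1 x.2 && ~~ x.1.2.

Lemma card_arcs : 6 * n ^ 2 <= #|arcs|.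
Proof.
pose f (x : (bool * 'I_3) * ('I_n * 'I_n)) : vert * vert :=
  let: ((s, i), (j, j')) := x in
  (((i, j), false), (((if s then ordS i else ord_pred i), j'), true)).
have f_inj : injective f.
  move=> [[s i] [j j']] [[s' i'] [k k']] [<- <- E <-].
  congr (_, _, _); move: E; case: s s' i => -[] // [[|[|[|//]]] hi];
    by move/(congr1 val).
have -> : 6 * n ^ 2 = #|[set: (bool * 'I_3) * ('I_n * 'I_n)]|.
  by rewrite cardsT !card_prod card_bool !card_ord mulnn.
rewrite -(card_imset _ f_inj); apply/subset_leq_card/subsetP => x.
case/imsetP => -[[s i] [j j']] _ ->; rewrite unfold_in /arcs /kron /Knnn /K2 /= !andbT.
by rewrite -(inj_eq val_inj); case: s i => -[[|[|[|//]]] hi].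
Qed.

Lemma blowup_lower (m : nat) : 0 < n -> planar_decomp graph m -> uphalf n.+1 <= m.
Proof.
move=> n0 [F [Fsub [Fpl Fcov]]].
pose E i := [pred x : vert * vert | F i x.1 x.2 && ~~ x.1.2].
have cV : #|{: vert}| = 6 * n by rewrite !card_prod card_bool !card_ord; lia.
have cE i : #|E i| <= 12 * n - 2.
  pose e u v := F i u v && ~~ u.2.
  have bip u v : e u v -> ~~ u.2 && v.2.
    by case/andP => /Fsub/andP[_]; rewrite /K2; case: u.2; case: v.2.
  have pe : planar e by apply: planar_sub (Fpl i) => u v /andP[].
  have V0 : 0 < #|{: vert}| by rewrite cV; lia.
  have H : #|E i| + 2 <= 2 * #|{: vert}| := planar_bip_bound V0 bip pe.
  by rewrite cV in H; lia.
have : #|arcs| <= m * (12 * n - 2).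
  rewrite -[m in m * _]card_ord -sum_nat_const.
  apply: leq_trans (_ : \sum_i #|E i| <= _); last by apply: leq_sum => i _; apply: cE.
  apply: leq_trans (_ : #|\bigcup_i [set x in E i]| <= _).
    apply/subset_leq_card/subsetP => x /andP[/Fcov[i Fi] x1].
    by apply/bigcupP; exists i => //; rewrite !inE Fi.
  elim/big_rec2: _ => [|i k A _ h]; first by rewrite cards0.
  apply: (leq_trans (leq_card_setU _ _)); rewrite cardsE; exact: leq_add.
move/(leq_trans card_arcs) => bound; have [//|lt] := leqP (uphalf n.+1) m.
(* With 2m <= n, doubling the bound gives 12n^2 <= n(12n - 2), which is absurd. *)
have := leq_mul2r (12 * n - 2) (2 * m) n; rewrite (_ : 2 * m <= n) ?orbT; last by lia.
by have : n * (12 * n - 2) < 12 * n ^ 2; nia.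
Qed.

End LowerBound.

Theorem theorem4p6 (n : nat) (hn : 0 < n) :
  thickness_is (kron (Knnn n) K2) (uphalf n.+1).
Proof.
by split; [exact: blowup_decomp|move=> m; exact: blowup_lower].
Qed.
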